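(* Let $Nneg(\mathbb A_n)$ be the number, up to isomorphism, of connected non-negative posets $I$ with $|I|=n$ and $\mathrm{Dyn}_I=\mathbb A_{n-\mathrm{crk}_I}$. Then $$Nneg(\mathbb A_n)=\begin{cases}1,& n\in\{1,2\},\\ 2^{n-2}+\frac{1}{2n}\sum_{d\mid n}2^{n/d}\varphi(d)+2^{\frac{n-3}{2}}-\lceil\frac{n+1}{2}\rceil,& n\ge3\text{ odd},\\ 2^{n-2}+\frac{1}{2n}\sum_{d\mid n}2^{n/d}\varphi(d)+2^{\frac n2-2}-\lceil\frac{n+1}{2}\rceil,& n\ge4\text{ even},\end{cases}$$ where $\varphi$ is Euler's totient function. In particular, for $n=1,\dots,21$ these numbers are $1,1,3,5,11,21,42,81,161,312,616,1209,2389,4711,9344,18497,36743,72955,145116,288633,574729$.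
   Context: For a finite poset $I$ on $\{1,\dots,n\}$: $C_I=[c_{ij}]$, $c_{ij}=1$ iff $i\preceq_I j$; $G_I=\tfrac12(C_I+C_I^{tr})$; $q_I(v)=vG_Iv^{tr}$; $I$ is non-negative of corank $\mathrm{crk}_I=r$ if $G_I$ is positive semi-definite of rank $n-r$; $I$ is connected if the underlying graph of its Hasse digraph (arrow $i\to j$ iff $i\prec_I j$ with nothing strictly between) is connected. Dynkin graphs: $\mathbb A_m$ path on $m$ vertices, $\mathbb D_m$ path on $m-1$ vertices plus a vertex attached to the second, $\mathbb E_6,\mathbb E_7,\mathbb E_8$ trees with one branch vertex and arms of $1,2,2$ / $1,2,3$ / $1,2,4$ vertices; $G_\Gamma=E_m-\tfrac12\mathrm{Adj}(\Gamma)$. Dynkin type of a connected non-negative $I$ of corank $r$: $\mathrm{Ker}\,q_I=\{v\in\mathbb Z^n:q_I(v)=0\}$ has a $\mathbb Z$-basis $h^{(1)},\dots,h^{(r)}$ with $h^{(i)}_{k_j}=\delta_{ij}$ for some $k_1<\dots<k_r$; $I'=I\setminus\{k_1,\dots,k_r\}$ is connected positive with $G_{I'}=B^{tr}G_DB$, $B\in GL(n-r,\mathbb Z)$, for a unique Dynkin graph $D$ on $n-r$ vertices; $\mathrm{Dyn}_I:=D$. *)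

(* Defs.v *)
From HB Require Import structures.
From mathcomp Require Import all_boot all_order all_algebra all_fingroup.
Set Implicit Arguments. Unset Strict Implicit. Unset Printing Implicit Defensive.
Import Order.TTheory GRing.Theory Num.Theory.
Local Open Scope ring_scope.

Definition is_poset (n : nat) (P : rel 'I_n) : Prop :=
  (forall i, P i i) /\
  (forall i j, P i j -> P j i -> i = j) /\
  (forall i j k, P i j -> P j k -> P i k).

Definition incmx (n : nat) (P : rel 'I_n) : 'M[rat]_n :=
  \matrix_(i, j) (P i j)%:R.
Definition gram (n : nat) (P : rel 'I_n) : 'M[rat]_n :=
  (1 / 2%:R) *: (incmx P + (incmx P)^T).

Definition intvec (n : nat) (v : 'rV[int]_n) : 'rV[rat]_n :=
  map_mx (fun x : int => x%:~R) v.
Definition qform (n : nat) (P : rel 'I_n) (v : 'rV[int]_n) : rat :=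
  (intvec v *m gram P *m (intvec v)^T) 0 0.

Definition psd (n : nat) (G : 'M[rat]_n) : Prop :=
  forall v : 'rV[rat]_n, 0 <= (v *m G *m v^T) 0 0.

Definition nonneg_crk (n : nat) (P : rel 'I_n) (r : nat) : Prop :=
  psd (gram P) /\ \rank (gram P) = (n - r)%N.
Definition nonneg (n : nat) (P : rel 'I_n) : Prop :=
  exists r, nonneg_crk P r.

Definition hasse (n : nat) (P : rel 'I_n) : rel 'I_n :=
  fun i j => [&& i != j, P i j &
     ~~ [exists k, [&& k != i, k != j, P i k & P k j]]].
Definition hasse_und (n : nat) (P : rel 'I_n) : rel 'I_n :=
  fun i j => hasse P i j || hasse P j i.
Definition connected_poset (n : nat) (P : rel 'I_n) : Prop :=
  forall i j, connect (hasse_und P) i j.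

(* G_{A_m} = E_m - 1/2 Adj(A_m), A_m the path 0 - 1 - ... - (m-1) *)
Definition gramA (m : nat) : 'M[rat]_m :=
  \matrix_(i, j) (if i == j then 1
                  else if ((i.+1 == j :> nat) || (j.+1 == i :> nat))
                       then - (1 / 2%:R) else 0).

(* Dyn_I = A_{n - crk_I}: Ker q_I has a Z-basis (h^(k))_{k in K} with
   h^(k)_{k'} = delta_{k k'} for k, k' in K, and I' = I \ K (enumerated by an
   injective f with image the complement of K) satisfies
   G_{I'} = B^tr G_{A_m} B for some B in GL(m, Z). Since #K = crk_I,
   m = n - crk_I. *)
Definition dyn_is_A (n : nat) (P : rel 'I_n) : Prop :=
  exists (K : {set 'I_n}) (h : 'I_n -> 'rV[int]_n),
    (forall k, k \in K -> qform P (h k) = 0) /\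
    (forall k k', k \in K -> k' \in K -> h k 0 k' = (k == k')%:Z) /\
    (forall v : 'rV[int]_n, qform P v = 0 ->
        exists c : 'I_n -> int, v = \sum_(k in K) c k *: h k) /\
    exists (m : nat) (f : 'I_m -> 'I_n) (B : 'M[int]_m),
      injective f /\ (forall i, (i \notin K) = (i \in codom f)) /\
      B \in unitmx /\
      \matrix_(i, j) gram P (f i) (f j) =
        (map_mx (fun x : int => x%:~R) B)^T *m gramA m
          *m map_mx (fun x : int => x%:~R) B.

Definition poset_iso (n : nat) (P Q : rel 'I_n) : Prop :=
  exists s : {perm 'I_n}, forall i j, P i j = Q (s i) (s j).

Definition nnegA (n : nat) (P : rel 'I_n) : Prop :=
  [/\ is_poset P, connected_poset P, nonneg P & dyn_is_A P].

Definition num_iso_classes (n : nat) (Pr : rel 'I_n -> Prop) (N : nat) : Prop :=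
  exists reps : 'I_N -> rel 'I_n,
    (forall a, Pr (reps a)) /\
    (forall a b, poset_iso (reps a) (reps b) -> a = b) /\
    (forall P, Pr P -> exists a, poset_iso P (reps a)).

Definition Nneg_formula (n : nat) : rat :=
  if (n <= 2)%N then 1
  else (2 ^ (n - 2))%:R
     + (\sum_(d <- divisors n) 2 ^ (n %/ d) * totient d)%:R / (2 * n)%:R
     + (if odd n then (2 ^ ((n - 3) %/ 2))%:R else (2 ^ (n %/ 2 - 2))%:R)
     - (uphalf n.+1)%:R.

(* Main.v *)
Require Import Defs.
From HB Require Import structures.
From mathcomp Require Import all_boot all_order all_algebra all_fingroup.
From mathcomp Require Import zify ring lra.
Set Implicit Arguments. Unset Strict Implicit. Unset Printing Implicit Defensive.
Import Order.TTheory GRing.Theory Num.Theory.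
Local Open Scope ring_scope.

(** If [I] is non-negative of Dynkin type A_m, then modulo the kernel of the form
    the basis vectors of Z^n become roots [e_a - e_b] of A_m with pairwise inner
    products 0 or 1. Hence every coordinate is used either only as a tail or only
    as a head: the roots are the edges of a bipartite graph, and two elements of
    [I] are comparable iff the corresponding edges meet. The triangles of such a
    line graph are stars, so every element has at most two neighbours in the Hasse
    diagram, which is therefore a path or a cycle; a cycle with a single sink is
    excluded because [i < a, b < m] with [a], [b] incomparable is not a line graph
    of this kind. Conversely, on a path, or on a cycle with at least two sinks, the
    roots attached to the maximal monotone runs realize the form, and they become
    triangular with unit diagonal in the basis [e_i - e_(i+1)] after at most one
    turning point is deleted.

    So the isomorphism classes are the dihedral orbits of cyclic words with letters
    [->], [<-] and at most one missing edge, except for the words with at most one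
    sink. By Burnside's lemma, rotations of words without gap give the totient sum,
    the identity on words with one gap gives 2^(n-2), the reflections give the
    parity-dependent term, and floor(n/2) + 1 orbits are excluded. *)

(** * Realizing a form by roots of type A *)

Notation toQ := (map_mx (intr : int -> rat)).

(** The rows are the simple roots e_i - e_(i+1) of A_m in Z^(m+1). *)
Definition rootmx (m : nat) : 'M[int]_(m, m.+1) :=
  \matrix_(i, j) ((j == i :> nat)%:R - (j == i.+1 :> nat)%:R).

(** Partial sums: they read off the coordinates of a vector of sum zero in the simple roots. *)
Definition cummx (m : nat) : 'M[int]_(m.+1, m) := \matrix_(i, j) (i <= j)%N%:R.

Lemma sum_delta (R : nzRingType) (N a : nat) (F : 'I_N -> R) (la : (a < N)%N) :
  \sum_(i < N) (i == a :> nat)%:R * F i = F (Ordinal la).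
Proof.
rewrite (bigD1 (Ordinal la)) //= eqxx mul1r big1 ?addr0 // => i ni.
by rewrite -val_eqE /= in ni; rewrite (negPf ni) mul0r.
Qed.

Lemma rootmxE m p (A : 'M[int]_(m.+1, p)) i j :
  (rootmx m *m A) i j = A (widen_ord (leqnSn m) i) j - A (lift ord0 i) j.
Proof.
rewrite mxE; under eq_bigr => k _ do rewrite mxE mulrBl.
rewrite sumrB (sum_delta (a := i)) ?ltnS 1?ltnW // => h1.
rewrite (sum_delta (a := i.+1)) ?ltnS // => h2.
by congr (A _ _ - A _ _); apply: val_inj.
Qed.

Lemma diff_cum m : rootmx m *m cummx m = 1%:M.
Proof.
apply/matrixP => i j; rewrite rootmxE !mxE /= /bump /= add1n.
by rewrite -val_eqE /=; case: ltngtP.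
Qed.

Lemma cum_diff n m (Y : 'M[int]_(n, m.+1)) :
  (forall i, \sum_j Y i j = 0) -> Y *m cummx m *m rootmx m = Y.
Proof.
move=> h; rewrite -mulmxA; apply/matrixP => i j; rewrite mxE.
(* The product is the identity with 1 subtracted throughout the last column, which only subtracts
   the row sum there. *)
have E k : (cummx m *m rootmx m) k j = (k == j)%:R - (j == ord_max)%:R.
  rewrite mxE; under eq_bigr => l _ do rewrite !mxE mulrBr.
  rewrite sumrB.
  have -> : \sum_(l < m) (k <= l)%N%:R * (j == l :> nat)%:R
      = ((j < m) && (k <= j))%N%:R :> int.
    have [lj|lj] := ltnP j m.
      under eq_bigr => l _ do rewrite mulrC eq_sym.
      by rewrite (sum_delta _ lj).
    by rewrite big1 // => l _; rewrite gtn_eqF ?mulr0 // (leq_trans (ltn_ord l)).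
  have -> : \sum_(l < m) (k <= l)%N%:R * (j == l.+1 :> nat)%:R
      = (k < j)%N%:R :> int.
    case: j => -[|j] lj /=; first by rewrite big1 // => l _; rewrite mulr0.
    under eq_bigr => l _ do rewrite mulrC eqSS eq_sym.
    by rewrite (sum_delta _ (lj : (j < m)%N)).
  rewrite -!val_eqE /=; have := ltn_ord j; have := ltn_ord k.
  rewrite !ltnS => *; have [->|nj] := eqVneq (j : nat) m.
    by rewrite ltnn /=; case: ltngtP => //=; lia.
  have -> : (j < m)%N by lia.
  by case: ltngtP.
under eq_bigr => k _ do rewrite E mulrBr.
rewrite sumrB -mulr_suml h mul0r subr0.
under eq_bigr => k _ do rewrite mulrC.
by rewrite (sum_delta _ (ltn_ord j)); congr (Y i _); apply: val_inj.
Qed.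

Lemma gramA_diff m : gramA m = (1 / 2%:R) *: toQ (rootmx m *m (rootmx m)^T).
Proof.
apply/matrixP => i j; rewrite !mxE.
have -> : \sum_k rootmx m i k * (rootmx m)^T k j = (rootmx m *m (rootmx m)^T) i j.
  by rewrite mxE.
rewrite rootmxE !mxE /= /bump /= !add1n -val_eqE /= !eqSS (eq_sym j.+1).
case: ltngtP => hij; case: eqP => h1; case: eqP => h2 //=; (lia || by apply/eqP).
Qed.

Lemma row_sqr_ge0 (R : realDomainType) n (v : 'rV[R]_n) : 0 <= (v *m v^T) 0 0.
Proof. by rewrite mxE sumr_ge0 // => i _; rewrite mxE -expr2 sqr_ge0. Qed.

Lemma row_sqr_eq0 (R : realDomainType) n (v : 'rV[R]_n) :
  (v *m v^T) 0 0 = 0 -> v = 0.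
Proof.
rewrite mxE => h; apply/rowP => i; rewrite mxE; apply/eqP.
have : \sum_j v 0 j ^+ 2 = 0 by rewrite -[RHS]h; apply: eq_bigr => j _; rewrite mxE.
by move/psumr_eq0P => /(_ (fun j _ => sqr_ge0 _)) /(_ i isT)/eqP; rewrite sqrf_eq0.
Qed.

Lemma quadratic_factor (R : comNzRingType) n N (v : 'rV[R]_n) (A : 'M_(n, N)) :
  v *m (A *m A^T) *m v^T = (v *m A) *m (v *m A)^T.
Proof. by rewrite trmx_mul !mulmxA. Qed.

Lemma gram_factor n N (P : rel 'I_n) (Y : 'M[int]_(n, N)) :
  (forall i j, (P i j)%:R + (P j i)%:R = (Y *m Y^T) i j) ->
  gram P = (1 / 2%:R) *: (toQ Y *m (toQ Y)^T).
Proof.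
move=> h; rewrite map_trmx -map_mxM; apply/matrixP => i j.
by rewrite !mxE; congr (_ * _); have := h i j; rewrite mxE => <-; rewrite rmorphD /= !rmorph_nat.
Qed.

Section Criterion.
Variables (n m : nat) (P : rel 'I_n) (X : 'M[int]_(n, m)) (f : 'I_m -> 'I_n).
Hypothesis Xgram : forall i j,
  (P i j)%:R + (P j i)%:R = (X *m rootmx m *m (X *m rootmx m)^T) i j.
Hypothesis f_inj : injective f.
Hypothesis Xf_unit : rowsub f X \in unitmx.

Let Y := X *m rootmx m.

Let gramE := gram_factor Xgram.

Lemma realized_nonneg : nonneg P.
Proof.
exists (n - \rank (gram P))%N; split; last by rewrite subKn ?rank_leq_row.
move=> v; rewrite gramE -scalemxAr -scalemxAl mxE mulr_ge0 //.
by rewrite quadratic_factor row_sqr_ge0.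
Qed.

(** The form is half the squared Euclidean length of [v *m Y], and [rootmx m] can be cancelled
    because it has a right inverse. *)
Let qform0 (v : 'rV[int]_n) : (qform P v = 0) <-> (v *m X = 0).
Proof.
rewrite /qform gramE -scalemxAr -scalemxAl mxE quadratic_factor.
rewrite -map_mxM; split=> h.
  have /row_sqr_eq0 : (toQ (v *m Y) *m (toQ (v *m Y))^T) 0 0 = 0.
    by apply/eqP; move/eqP: h; rewrite mulf_eq0.
  move=> h0; have : v *m Y = 0.
    by apply/rowP=> i; have /rowP/(_ i) := h0; rewrite !mxE => /eqP; rewrite intr_eq0 => /eqP.
  by move/(congr1 (mulmx^~ (cummx m))); rewrite /Y mul0mx mulmxA -!mulmxA diff_cum mulmx1.
by rewrite mulmxA h mul0mx raddf0 mul0mx mxE mulr0.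
Qed.

(** The rows of [X] chosen by [f] form a basis of Z^m, so the other rows are integral combinations
    of them; these relations form the basis of the kernel. *)
Lemma realized_dyn_is_A : dyn_is_A P.
Proof.
pose K := [set i | i \notin codom f].
(* From e_k subtract the combination of the vectors e_(f j) that has the same image under [X]. *)
pose h (k : 'I_n) : 'rV[int]_n :=
  delta_mx 0 k - row k X *m invmx (rowsub f X) *m rowsub f 1%:M.
have hX k : h k *m X = 0.
  by rewrite mulmxBl -rowE -!mulmxA (mul_rowsub_mx f 1%:M) mul1mx mulVmx // mulmx1 subrr.
have suppf (u : 'rV[int]_m) k : k \in K -> (u *m rowsub f 1%:M) 0 k = 0.
  rewrite inE => kf; rewrite mxE big1 // => j _; rewrite !mxE.
  by case: eqP => [fk|_]; [rewrite -fk codom_f in kf | rewrite mulr0].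
have hK k k' : k \in K -> k' \in K -> h k 0 k' = (k == k')%:Z.
  move=> kK k'K; rewrite mxE [X in X + _]mxE [X in _ + X]mxE suppf // oppr0 addr0 eqxx eq_sym.
  by case: (k == k').
exists K, h; split; first by move=> k _; apply/qform0.
split; first exact: hK.
split.
  move=> v /qform0 vX; exists (fun k => v 0 k).
  apply/eqP; rewrite -subr_eq0; set u := v - _.
  have uX : u *m X = 0.
    rewrite mulmxBl vX mulmx_suml big1 ?subr0 // => k _.
    by rewrite -scalemxAl hX scaler0.
  have uK k : k \in K -> u 0 k = 0.
    move=> kK; rewrite !mxE summxE (bigD1 k) //= mxE hK // eqxx mulr1.
    by rewrite big1 ?addr0 ?subrr // => k' /andP[k'K nk]; rewrite mxE hK // (negPf nk) mulr0.
  clearbody u.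
  have uE : u = (\row_j u 0 (f j)) *m rowsub f 1%:M.
    apply/rowP => k; case: (boolP (k \in K)) => kK; first by rewrite uK ?suppf.
    move: kK; rewrite inE negbK => /codomP[j ->]; rewrite [RHS]mxE (bigD1 j) //= !mxE eqxx mulr1.
    by rewrite big1 ?addr0 // => l nl; rewrite !mxE (inj_eq f_inj) (negPf nl) mulr0.
  move: uX; rewrite uE -mulmxA (mul_rowsub_mx f 1%:M) mul1mx.
  move/(congr1 (mulmx^~ (invmx (rowsub f X)))); rewrite mul0mx -mulmxA mulmxV // mulmx1 => ->.
  by rewrite mul0mx.
exists m, f, (rowsub f X)^T; split=> //; split.
  by move=> i; rewrite inE negbK.
split; first by rewrite unitmx_tr.
rewrite -[map_mx _ _]/(toQ _) gramA_diff -scalemxAr -scalemxAl -map_trmx trmxK map_trmx -!map_mxM.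
have -> : rowsub f X *m (rootmx m *m (rootmx m)^T) *m (rowsub f X)^T
  = rowsub f Y *m (rowsub f Y)^T.
  by rewrite /Y -mul_rowsub_mx trmx_mul !mulmxA.
apply/matrixP => i j; rewrite mxE gramE map_trmx -map_mxM !mxE.
by congr (_ * _%:~R); apply: eq_bigr => k _; rewrite !mxE.
Qed.

End Criterion.

(** * Extracting a line graph from the Dynkin type *)

(** With w = vG, s = |w|^2 and Q the value at w, the form takes the value - s^2 (Q + 2) at (Q + 1) v
    - s w. Since Q >= 0, non-negativity forces s = 0. *)
Lemma psd_isotropic n (G : 'M[rat]_n) (v : 'rV[rat]_n) :
  psd G -> G^T = G -> (v *m G *m v^T) 0 0 = 0 -> v *m G = 0.
Proof.
move=> Gpsd Gsym v0; apply: row_sqr_eq0; set w := v *m G.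
set s := (w *m w^T) 0 0; pose Q := (w *m G *m w^T) 0 0.
have vw : (w *m G *m v^T) 0 0 = s.
  by rewrite -mulmxA -{1}Gsym -trmx_mul.
have := Gpsd ((Q + 1) *: v - s *: w); have := Gpsd w; rewrite -/Q => Q0.
rewrite [X in _ *m X]linearB /= [X in _ *m (X - _)]linearZ [X in _ *m (_ - X)]linearZ /=.
rewrite !mulmxBl !mulmxBr -!scalemxAl -!scalemxAr -/w.
have mE (A C : 'M[rat]_1) : (A - C) 0 0 = A 0 0 - C 0 0 by rewrite !mxE.
have zE a (A : 'M[rat]_1) : (a *: A) 0 0 = a * A 0 0 by rewrite mxE.
rewrite !mE !zE v0 vw -/s -/Q => h.
have s2 : s ^+ 2 * (Q + 2) <= 0 by lra.
apply/eqP; rewrite -sqrf_eq0 eq_le sqr_ge0 andbT.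
by move: s2; rewrite pmulr_lle0 //; lra.
Qed.

Lemma nnegA_factor n (P : rel 'I_n) : nonneg P -> dyn_is_A P ->
  exists (m : nat) (X : 'M[int]_(n, m)), forall i j,
    (P i j)%:R + (P j i)%:R = (X *m rootmx m *m (X *m rootmx m)^T) i j.
Proof.
move=> [r [Gpsd _]] [K [h [hq [hK [_ [m [f [B [f_inj [Kf [_ GB]]]]]]]]]]].
have Gsym : (gram P)^T = gram P.
  by apply/matrixP => i j; rewrite !mxE [X in _ * X]addrC.
have hG k : k \in K -> toQ (h k) *m gram P = 0.
  by move=> kK; apply: psd_isotropic => //; apply: hq.
(* [T] changes e_k, for k in K, by a kernel vector so that it loses its K-coordinates. Thus [T]
   preserves the form and factors through I'. *)
pose T : 'M[int]_n := \matrix_i (delta_mx 0 i - (if i \in K then h i else 0)).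
have TG : toQ T *m gram P = gram P.
  apply/row_matrixP => i; rewrite row_mul -map_row rowK.
  rewrite map_mxB mulmxBl map_delta_mx -rowE; case: ifP => iK; rewrite ?hG ?subr0 //.
  by rewrite map_mx0 mul0mx subr0.
have TK i k : k \in K -> T i k = 0.
  move=> kK; rewrite !mxE eqxx /= eq_sym; case: ifP => iK.
    by rewrite hK //; case: (i == k).
  by rewrite mxE subr0; case: eqP => // ik; rewrite ik kK in iK.
have Tf : T = colsub f T *m rowsub f 1%:M.
  apply/matrixP => i k; rewrite [RHS]mxE; case: (boolP (k \in K)) => kK.
    rewrite TK // big1 // => j _; rewrite [X in _ * X]mxE [X in _ * X]mxE; case: eqP => [fk|_]; last by rewrite mulr0.
    by have := Kf k; rewrite kK -fk codom_f.
  move: kK; rewrite Kf => /codomP[j ->]; rewrite (bigD1 j) //= [X in X * _ + _]mxE [X in _ * X + _]mxE [X in _ * X + _]mxE eqxx mulr1.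
  by rewrite big1 ?addr0 // => l nl; rewrite [X in _ * X]mxE [X in _ * X]mxE (inj_eq f_inj) (negPf nl) mulr0.
exists m, (colsub f T *m B^T).
have E : gram P = (1 / 2%:R) *: toQ (colsub f T *m B^T *m rootmx m *m (colsub f T *m B^T *m rootmx m)^T).
  have -> : gram P = toQ T *m gram P *m (toQ T)^T.
    by rewrite TG -[RHS]trmxK trmx_mul trmxK Gsym TG Gsym.
  have RGR : toQ (rowsub f 1%:M) *m gram P *m (toQ (rowsub f 1%:M))^T
     = \matrix_(i, j) gram P (f i) (f j).
    apply/matrixP => i j; rewrite map_mxsub map_mx1 mul_rowsub_mx mul1mx.
    by rewrite trmx_mxsub trmx1 mulmx_colsub mulmx1 !mxE.
  rewrite {1 2}Tf map_mxM trmx_mul -!mulmxA [toQ _ *m (gram P *m _)]mulmxA.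
  rewrite [toQ _ *m gram P *m _]mulmxA RGR GB -/(toQ B) gramA_diff.
  rewrite -!scalemxAr -!scalemxAl -!scalemxAr !trmx_mul trmxK !map_mxM !map_trmx !mulmxA.
  by [].
move=> i j; apply: (@intr_inj rat); move/matrixP/(_ i j): E; rewrite !mxE.
rewrite rmorphD /= !rmorph_nat => /(congr1 ( *%R 2%:R)).
by rewrite !mulrA divff // !mul1r.
Qed.

(** A nonzero integral vector of sum zero has a positive and a negative entry, and these two already
    use up the squared length 2. *)
Lemma root_shape N (y : 'I_N -> int) :
  \sum_c y c = 0 -> \sum_c y c ^+ 2 = 2 ->
  exists a b, a != b /\ forall c, y c = (c == a)%:R - (c == b)%:R.
Proof.
have pos (z : 'I_N -> int) : \sum_c z c = 0 -> \sum_c z c ^+ 2 = 2 -> exists a, 0 < z a.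
  move=> z0 z2; apply/existsP; rewrite -[X in is_true X]negbK negb_exists; apply/negP => /forallP h.
  have h0 : \sum_c - z c = 0 by rewrite sumrN z0 oppr0.
  have /psumr_eq0P/(_ h0) hz : forall c, true -> 0 <= - z c.
    by move=> c _; rewrite oppr_ge0 leNgt.
  by move: z2; rewrite big1 // => c _; rewrite -[z c]opprK hz // oppr0 expr0n.
move=> y0 y2; have [a ya] := pos _ y0 y2.
have [||b] := pos (fun c => - y c).
- by rewrite sumrN y0 oppr0.
- by rewrite -[RHS]y2; apply: eq_bigr => c _; rewrite sqrrN.
rewrite oppr_gt0 => yb; have nab : a != b by apply: contraTneq ya => ->; rewrite -leNgt ltW.
exists a, b; split=> //.
move: y2; rewrite (bigD1 a) //= (bigD1 b) 1?eq_sym //=.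
set S := \sum_(i | _) _ => y2.
have S0 : 0 <= S by apply: sumr_ge0 => c _; apply: sqr_ge0.
have SE : S = 0 by nia.
have ya1 : y a = 1 by nia.
have yb1 : y b = -1 by nia.
move=> c; have [->|ca] := eqVneq c a; first by rewrite (negPf nab) ya1.
have [->|cb] := eqVneq c b; first by rewrite yb1.
move/psumr_eq0P: SE => /(_ (fun c _ => sqr_ge0 _)) /(_ c).
by rewrite ca cb => /(_ isT)/eqP; rewrite sqrf_eq0 => /eqP.
Qed.

(** Each element is a root e_a - e_b, recorded by [s] and [t]. By antisymmetry distinct elements
    have inner product 0 or 1. A head of one equal to the tail of the other would make it negative,
    and two equal roots would give 2. *)
Lemma nnegA_line n (P : rel 'I_n) : nnegA P ->
  exists N (s t : 'I_n -> 'I_N), forall i j, i != j ->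
    (P i j || P j i) = (s i == s j) || (t i == t j) /\ ~~ ((s i == s j) && (t i == t j)).
Proof.
move=> [[Prefl [Panti _]] _ Pnn /(nnegA_factor Pnn)[m [X hX]]].
pose Y := X *m rootmx m.
have Ysum i : \sum_c Y i c = 0.
  rewrite /Y; under eq_bigr do rewrite mxE.
  rewrite exchange_big big1 // => k _; rewrite -mulr_sumr.
  under eq_bigr do rewrite mxE.
  rewrite sumrB.
  have sum1 a : (a < m.+1)%N -> \sum_(c < m.+1) (c == a :> nat)%:R = 1 :> int.
    by move=> la; under eq_bigr do rewrite -[_%:R]mulr1; rewrite (sum_delta _ la).
  by rewrite !sum1 ?subrr ?mulr0 // ltnS // ltnW.
have YY i j : \sum_c Y i c * Y j c = (P i j)%:R + (P j i)%:R.
  by rewrite hX mxE; apply: eq_bigr => c _; rewrite [X in _ = _ * X]mxE.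
have /fin_all_exists[ab hab] i : exists ab : 'I_m.+1 * 'I_m.+1,
   ab.1 != ab.2 /\ forall c, Y i c = (c == ab.1)%:R - (c == ab.2)%:R.
  have [||a [b ?]] := @root_shape _ (Y i); last by exists (a, b).
  + exact: Ysum.
  + by under eq_bigr do rewrite expr2; rewrite YY Prefl.
exists m.+1, (fun i => (ab i).1), (fun i => (ab i).2) => i j nij.
have : \sum_c Y i c * Y j c = ((ab i).1 == (ab j).1)%:R + ((ab i).2 == (ab j).2)%:R
  - ((ab i).1 == (ab j).2)%:R - ((ab i).2 == (ab j).1)%:R.
  have [_ hi] := hab i; have [_ hj] := hab j.
  under eq_bigr do rewrite hi hj mulrBl.
  have d (a : 'I_m.+1) F : \sum_c (c == a)%:R * F c = F a :> int.
    by rewrite (bigD1 a) //= eqxx mul1r big1 ?addr0 // => c /negPf->; rewrite mul0r.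
  by rewrite sumrB !d; ring.
rewrite YY; have := Panti i j; have [ni _] := hab i; have [nj _] := hab j.
move: ni nj nij; case: (ab i) => a b; case: (ab j) => a' b' /=.
by do ?case: eqP => ?; case: (P i j); case: (P j i) => //= ; subst; try tauto.
Qed.

(** * Hasse diagrams of line-graph posets *)

Section HasseOfPoset.
Variables (n : nat) (P : rel 'I_n).
Hypothesis Pposet : is_poset P.

Let Prefl : reflexive P. Proof. by case: Pposet. Qed.
Let Panti i j : P i j -> P j i -> i = j. Proof. by case: Pposet => _ [h _]; apply: h. Qed.
Let Ptrans i j k : P i j -> P j k -> P i k. Proof. by case: Pposet => _ [_ h]; apply: h. Qed.

Lemma hasseP i j : reflect
  [/\ i != j, P i j & forall k, P i k -> P k j -> k = i \/ k = j] (hasse P i j).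
Proof.
apply: (iffP and3P) => [[nij ij /existsPn h]|[nij ij h]]; split=> //.
  move=> k ik kj; have := h k; rewrite ik kj !andbT.
  by case: eqP => [|_]; [left|case: eqP => [|//]; right].
apply/existsPn => k; apply/and4P => -[/eqP ki /eqP kj ik jk].
by case: (h k ik jk).
Qed.

Lemma poset_connect_hasse : P =2 connect (hasse P).
Proof.
move=> i j; apply/idP/idP; last first.
  move/connectP => [p ip ->]; elim: p i ip => [|k p IH] i /=; first by rewrite Prefl.
  by case/andP => /and3P[_ ik _] /IH; apply: Ptrans.
have [m] := ubnP #|[set k | P i k && P k j]|; elim: m i j => // m IH i j; rewrite ltnS => cm ij.
have [->|nij] := eqVneq i j; first exact: connect0.
case: (boolP (hasse P i j)) => [|]; first exact: connect1.
rewrite /hasse nij ij /= negbK => /existsP[k /and4P[ki kj ik jk]].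
have sub a b : P i a -> P b j -> [set k | P a k && P k b] \subset [set k | P i k && P k j].
  move=> ia bj; apply/subsetP => x; rewrite !inE => /andP[ax xb].
  by rewrite (Ptrans ia ax) (Ptrans xb bj).
apply: (@connect_trans _ _ k); apply: IH => //; apply: leq_trans cm;
  apply: proper_card; apply/properP; (split; first exact: sub).
  exists j; rewrite !inE ?ij ?Prefl //=; apply/negP => jk'.
  by move: kj; rewrite (Panti jk jk') eqxx.
exists i; rewrite !inE ?ij ?Prefl ?andbT //=; apply/negP => ki'.
by move: ki; rewrite (Panti ik ki') eqxx.
Qed.

Variables (N : nat) (s t : 'I_n -> 'I_N).
Hypothesis Pline : forall i j, i != j ->
    (P i j || P j i) = (s i == s j) || (t i == t j) /\ ~~ ((s i == s j) && (t i == t j)).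

(* A triangle in the line graph of a bipartite graph is a star, hence its three
   edges share one endpoint. *)
Lemma line_triangle x y z : x != y -> y != z -> P x y -> P y z ->
  (s x == s y) = (s y == s z).
Proof.
move=> xy yz Pxy Pyz; have Pxz := Ptrans Pxy Pyz.
have xz : x != z.
  by apply: contraNneq xy => xz; rewrite (Panti Pxy) // xz.
have [] := Pline xy; have [] := Pline yz; have [] := Pline xz.
rewrite Pxy Pyz Pxz /=.
case: (s x =P s y) => ?; case: (s y =P s z) => ?; case: (s x =P s z) => ?;
  case: (t x =P t y) => ?; case: (t y =P t z) => ?; case: (t x =P t z) => ? //=; congruence.
Qed.

Lemma line_antichain x y : x != y -> ~~ P x y -> ~~ P y x -> (s x != s y) && (t x != t y).
Proof.
by move=> xy /negPf a /negPf b; have [] := Pline xy; rewrite a b /= -negb_or => <-.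
Qed.

(** Two covers on the same side of [y] are incomparable, so they meet [y] at different endpoints;
    one above and one below form a chain with [y] and meet it at the same endpoint. Hence the
    exclusive or of the bits for side and endpoint differs for any two neighbours, which leaves room
    for two only. *)
Lemma line_hasse_degree y (z1 z2 z3 : 'I_n) :
  hasse_und P y z1 -> hasse_und P y z2 -> hasse_und P y z3 ->
  z1 != z2 -> z1 != z3 -> z2 != z3 -> False.
Proof.
pose up z := hasse P y z.
have key z z' : hasse_und P y z -> hasse_und P y z' -> z != z' ->
    (up z == up z') = ((s y == s z) != (s y == s z')).
  have comp a b c : hasse P a b -> P a c -> P c b -> a = c \/ b = c.
    by case/hasseP => _ _ h ac cb; case: (h c ac cb) => ->; [left|right].
  have same a b : y != a -> y != b -> a != b -> ~~ P a b -> ~~ P b a ->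
      P y a || P a y -> P y b || P b y -> (s y == s a) != (s y == s b).
    move=> ya yb ab nab nba.
    have [-> h1] := Pline ya; have [-> h2] := Pline yb; move: h1 h2.
    have /andP[] := line_antichain ab nab nba.
    by do ?[case: eqP => //= ?]; try congruence.
  have ud a b : up a -> hasse P b y -> (s y == s a) = (s y == s b).
    move=> /hasseP[ya ya' _] /hasseP[byn by' _].
    by rewrite -(line_triangle byn ya by' ya') eq_sym.
  rewrite /hasse_und -/(up z) -/(up z').
  case: (boolP (up z)) => [uz _|nz /= zy]; case: (boolP (up z')) => [uz' _|nz' /= z'y] zz'.
  - have /hasseP[a1 a2 a3] := uz; have /hasseP[b1 b2 b3] := uz'.
    rewrite same // ?a2 ?b2 //; apply/negP => h.
      by have [e|e] := b3 _ a2 h; [rewrite e eqxx in a1|rewrite e eqxx in zz'].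
    by have [e|e] := a3 _ b2 h; [rewrite e eqxx in b1|rewrite e eqxx in zz'].
  - by rewrite (ud z z') // eqxx.
  - by rewrite (ud z' z) // eqxx.
  - have /hasseP[a1 a2 a3] := zy; have /hasseP[b1 b2 b3] := z'y.
    rewrite same // ?a2 ?b2 ?orbT // 1?eq_sym //; apply/negP => h.
      by have [e|e] := a3 _ h b2; [rewrite e eqxx in zz'|rewrite e eqxx in b1].
    by have [e|e] := b3 _ h a2; [rewrite e eqxx in zz'|rewrite e eqxx in a1].
move=> h1 h2 h3 /(key _ _ h1 h2) + /(key _ _ h1 h3) + /(key _ _ h2 h3).
by case: (up z1); case: (up z2); case: (up z3); case: (s y == s z1); case: (s y == s z2);
  case: (s y == s z3).
Qed.

(** The incomparable edges [a] and [b] meet [i] at its two different endpoints. Each chain through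
    [a] or [b] shares one endpoint, so [m] contains both endpoints of [i] and is parallel to it. *)
Lemma line_no_diamond i a b m : hasse P i a -> hasse P i b -> a != b ->
  P a m -> P b m -> False.
Proof.
move=> /hasseP[ia Pia ha] /hasseP[ib Pib hb] ab am bm.
have nab : ~~ P a b.
  by apply/negP => /(hb _ Pia)[e|e]; [rewrite e eqxx in ia|rewrite e eqxx in ab].
have nba : ~~ P b a.
  by apply/negP => /(ha _ Pib)[e|e]; [rewrite e eqxx in ib|rewrite e eqxx in ab].
have anm : a != m by apply: contraNneq nba => ->.
have bnm : b != m by apply: contraNneq nab => ->.
have /andP[nsab ntab] := line_antichain ab nab nba.
have im : i != m by apply: contraNneq ia => im; rewrite (Panti Pia) // im.
have /negP him := (Pline im).2; have [_ hia] := Pline ia; have [_ hib] := Pline ib.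
have [] := Pline anm; have [] := Pline bnm; have [] := Pline ia; have [] := Pline ib.
have := line_triangle ib bnm Pib bm; have := line_triangle ia anm Pia am.
rewrite am bm Pia Pib /=; move: nsab ntab => /eqP ? /eqP ?.
by case: (s i =P s a) => ?; case: (s i =P s b) => ?; case: (t i =P t a) => ?;
  case: (t i =P t b) => ? //=; try congruence;
  case: (s a =P s m) => ?; case: (s b =P s m) => ? //=; try congruence;
  case: (t a =P t m) => ?; case: (t b =P t m) => ? //=;
  solve [congruence | case: him; apply/andP; split; apply/eqP; congruence].
Qed.

End HasseOfPoset.

(** * Connected graphs of maximal degree two *)

Section LongestPath.
Variables (T : finType) (e : rel T).
Hypothesis esym : symmetric e.
Hypothesis econn : forall x y, connect e x y.
Hypothesis edeg : forall y z1 z2 z3, e y z1 -> e y z2 -> e y z3 ->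
  z1 != z2 -> z1 != z3 -> z2 != z3 -> False.

(** Take a longest path. Its interior vertices have both neighbours on it and its ends cannot be
    extended, so it is closed under adjacency and covers the graph. The only further edge possible
    joins the two ends. *)
Lemma path_enumeration (x0 : T) : exists l : seq T,
  [/\ uniq l, forall x, x \in l, 
      forall i, (i.+1 < size l)%N -> e (nth x0 l i) (nth x0 l i.+1)
    & forall i j, (i < j < size l)%N -> e (nth x0 l i) (nth x0 l j) ->
        j = i.+1 \/ i = 0%N /\ j.+1 = size l].
Proof.
pose Q k := [exists l : k.+1.-tuple T, uniq l && sorted e l].
have Q0 : exists k, Q k by exists 0%N; apply/existsP; exists [tuple x0].
have Qle k : Q k -> (k <= #|T|)%N.
  move=> /existsP[l /andP[/card_uniqP ul _]]; rewrite ltnW // -[k.+1](size_tuple l) -ul.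
  exact: max_card.
case: (ex_maxnP Q0 Qle) => k /existsP[l0 /andP[ul sl]] kmax.
have sz : size l0 = k.+1 := size_tuple l0.
exists l0; move: ul sl sz; move: (l0 : seq T) => l ul sl sz {l0}.
have lnext i : (i.+1 < size l)%N -> e (nth x0 l i) (nth x0 l i.+1).
  by move=> il; apply: (sortedP x0 sl).
have maxl l' : uniq l' -> sorted e l' -> (size l' <= k.+1)%N.
  move=> ul' sl'; case El : l' => [|a l''] //; rewrite -El.
  have sz' : size l' == (size l'').+1 by rewrite El.
  suff : Q (size l'') by move/kmax; rewrite El.
  by apply/existsP; exists (Tuple sz'); rewrite ul' sl'.
have nthneq i j : (i < size l)%N -> (j < size l)%N -> i != j -> nth x0 l i != nth x0 l j.
  by move=> il jl ij; rewrite nth_uniq.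
have interior i z : (0 < i)%N -> (i.+1 < size l)%N -> e (nth x0 l i) z ->
    z = nth x0 l i.-1 \/ z = nth x0 l i.+1.
  move=> i0 il ez; case: (z =P nth x0 l i.-1) => [|/eqP n1]; first by left.
  case: (z =P nth x0 l i.+1) => [|/eqP n2]; first by right.
  have e1 : e (nth x0 l i) (nth x0 l i.-1).
    by rewrite esym -{2}(prednK i0) lnext // prednK // ltnW.
  case: (edeg ez e1 (lnext _ il) n1 n2); apply: nthneq => //; lia.
have closed_l x z : x \in l -> e x z -> z \in l.
  move=> /(nthP x0)[i il <-] ez; apply/negPn/negP => zl.
  have [i0|i0] := posnP i.
    have := maxl (z :: l); rewrite /= zl ul sz ltnn => /(_ isT).
    by case: l ez {ul zl lnext nthneq interior} sz il sl {maxl} => //= a l; rewrite i0 /= esym => -> _ _ -> /(_ isT).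
  have [il'|il'] := ltnP i.+1 (size l).
    have [E|E] := interior i z i0 il' ez; move: zl; rewrite E mem_nth //; lia.
  have := maxl (rcons l z); rewrite rcons_uniq zl ul size_rcons sz ltnn => /(_ isT) h.
  apply: notF; apply: h; case: l ez {ul zl lnext nthneq interior} sl il il' sz => //= a l ez sl il il' sz.
  rewrite rcons_path sl /= -[last a l]/(last x0 (a :: l)) -nth_last /=.
  by have -> : size l = i by lia.
have all_l x : x \in l.
  have hl : nth x0 l 0 \in l by rewrite mem_nth // sz.
  have /connectP[p] := econn (nth x0 l 0) x.
  elim: p (nth x0 l 0) hl => [|y p IH] z zl /=; first by move=> _ ->.
  by case/andP => zy; apply: IH; apply: closed_l zy.
split=> // i j /andP[ij jl] eij; have [ji|ji] := eqVneq j i.+1; first by left.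
right; have il : (i.+1 < size l)%N by apply: leq_ltn_trans jl.
have nth_eq a b : (a < size l)%N -> (b < size l)%N -> nth x0 l a = nth x0 l b -> a = b.
  by move=> al bl /eqP; rewrite nth_uniq // => /eqP.
have [i0|i0] := posnP i; last first.
  have [/nth_eq|/nth_eq] := interior i _ i0 il eij; lia.
split=> //; apply/eqP; rewrite eqn_leq jl leqNgt /=; apply/negP => jl'.
have j0 : (0 < j)%N by apply: leq_ltn_trans ij.
rewrite esym in eij; have [/nth_eq|/nth_eq] := interior j _ j0 jl' eij; lia.
Qed.

End LongestPath.

(** * Posets of cyclic words *)

(* The letter [w i] describes the edge between the residues [i] and [i + 1] of
   the cycle Z/(n+3): [Some true] is [i -> i + 1], [Some false] is [i + 1 -> i]
   and [None] is a missing edge. *)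
Notation word n := {ffun 'I_n.+3 -> option bool}.

Section Residues.
Variable n : nat.
Implicit Types i j : 'I_n.+3.

Lemma val_residue t : (t%:R : 'I_n.+3) = (t %% n.+3)%N :> nat.
Proof. by rewrite Zp_nat. Qed.

Lemma residue_eq0 t : ((t%:R : 'I_n.+3) == 0) = (n.+3 %| t)%N.
Proof. by rewrite -val_eqE /= val_residue. Qed.

Lemma residue_full : n.+3%:R = 0 :> 'I_n.+3.
Proof. by apply/eqP; rewrite residue_eq0. Qed.

Lemma residue_val i : (i : nat)%:R = i.
Proof. exact: natr_Zp. Qed.

Lemma residue_shift i j : exists2 t, (t < n.+3)%N & j = i + t%:R.
Proof. by exists (j - i : 'I_n.+3); rewrite ?ltn_ord // residue_val addrC subrK. Qed.

Lemma addr1_neq i : i + 1 != i.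
Proof. by rewrite -subr_eq0 addrAC subrr add0r (residue_eq0 1) gtnNdvd. Qed.

(** With at least three residues, an ordered pair of neighbours determines which letter joins
    them. *)
Lemma addr2_neq i : i + 1 + 1 != i.
Proof. by rewrite -[i + 1 + 1]addrA -subr_eq0 addrAC subrr add0r (residue_eq0 2) gtnNdvd. Qed.

End Residues.

Definition arr n (w : word n) : rel 'I_n.+3 := fun i j =>
  ((j == i + 1) && (w i == Some true)) || ((i == j + 1) && (w j == Some false)).
Definition word_rel n (w : word n) : rel 'I_n.+3 := connect (arr w).
Definition run n (w : word n) (b : bool) (i : 'I_n.+3) (l : nat) : Prop :=
  forall t, (t < l)%N -> w (i + t%:R) = Some b.

(** The gapless words with at most one sink; the range of [l] includes 0 and n + 3, which give the
    two oriented cycles. *)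
Definition unimodal n (w : word n) : bool :=
  [exists i, [exists l : 'I_n.+4, [forall t, w (i + t) == Some (t < l)%N]]].
Definition gaps n (w : word n) : nat := #|[set i | w i == None]|.
Definition good_word n (w : word n) : bool := (gaps w <= 1)%N && ~~ unimodal w.

Section Words.
Variables (n : nat) (w : word n).
Implicit Types i j k : 'I_n.+3.

Lemma unimodalP : reflect
  (exists i l, (l <= n.+3)%N /\ forall t, (t < n.+3)%N -> w (i + t%:R) = Some (t < l)%N)
  (unimodal w).
Proof.
apply: (iffP existsP) => [[i /existsP[l /forallP h]]|[i [l [ln h]]]]; exists i.
  exists l; split; first by rewrite -ltnS.
  by move=> t tn; have /eqP := h (Ordinal tn); rewrite -[X in i + X]residue_val.
apply/existsP; exists (Ordinal (ln : (l < n.+4)%N)); apply/forallP => t.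
by rewrite -{1}[t]residue_val h.
Qed.

Lemma run_cat b i l l' : run w b i l -> run w b (i + l%:R) l' -> run w b i (l + l').
Proof.
move=> h h' t tl; have [/h //|lt] := ltnP t l.
by rewrite -(subnKC lt) natrD addrA h' // -(ltn_add2l l) subnKC.
Qed.

Lemma run_tail b i l : run w b i l.+1 -> run w b (i + 1) l.
Proof. by move=> h t tl; rewrite -addrA nat1r h. Qed.

(** A directed path cannot turn back, since the edge just used would need both letters; it therefore
    follows one monotone run. *)
Lemma word_relP i j : reflect
  (exists l, (j = i + l%:R /\ run w true i l) \/ (i = j + l%:R /\ run w false j l))
  (word_rel w i j).
Proof.
rewrite /word_rel; apply: (iffP idP) => [/connectP[p]|[l [[-> h]|[-> h]]]]; last 1 first.
- elim: l h => [|l IH] h; first by rewrite addr0 connect0.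
  apply: (@connect_trans _ _ (j + l%:R)); last by apply: IH => t tl; apply: h; lia.
  by apply: connect1; rewrite /arr -natr1 addrA eqxx h // orbT.
- elim/last_ind: p j => [|p j' IH] j /=; first by move=> _ ->; exists 0%N; left; rewrite addr0; split.
  rewrite rcons_path last_rcons => /andP[ip arrk] ->; have [l] := IH _ ip erefl.
  move: (last i p) arrk => k arrk [[kE h]|[iE h]].
    case/orP: arrk => /andP[/eqP jE /eqP wk].
      exists l.+1; left; rewrite jE kE -natr1 addrA; split=> //.
      by rewrite -addn1; apply: run_cat => // -[|//] _; rewrite addr0 -kE.
    case: l => [|l] in kE h *.
      by exists 1%N; right; rewrite -jE kE addr0; split=> // -[|//] _; rewrite addr0.
    have : k = i + l%:R + 1 by rewrite kE -natr1 addrA.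
    by rewrite jE => /addIr jE'; have := h l (ltnSn l); rewrite -jE' wk.
  case/orP: arrk => /andP[/eqP jE /eqP wk].
    case: l => [|l] in iE h *.
      exists 1%N; left; rewrite iE addr0 jE; split=> // -[|//] _.
      by rewrite addr0.
    by have := h 0%N isT; rewrite addr0 wk.
  exists l.+1; right; rewrite iE jE -addrA -mulrS; split=> //.
  by rewrite -add1n; apply: run_cat; [move=> -[|//] _; rewrite addr0 | rewrite -jE].
elim: l h => [|l IH] h; first by rewrite addr0 connect0.
apply: (@connect_trans _ _ (i + l%:R)); first by apply: IH => t tl; apply: h; lia.
by apply: connect1; rewrite /arr -natr1 addrA eqxx h.
Qed.

Lemma arr_irr : irreflexive (arr w).
Proof. by move=> i; rewrite /arr eq_sym (negPf (addr1_neq i)). Qed.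

Lemma arr_succ i : arr w i (i + 1) = (w i == Some true).
Proof. by rewrite /arr eqxx /= [i == _]eq_sym (negPf (addr2_neq i)) orbF. Qed.

Lemma arr_pred i : arr w (i + 1) i = (w i == Some false).
Proof. by rewrite /arr eqxx /= [i == _]eq_sym (negPf (addr2_neq i)). Qed.

Hypothesis wuni : ~~ unimodal w.

Lemma run_lt b i l : run w b i l -> (l < n.+3)%N.
Proof.
move=> h; rewrite ltnNge; apply/negP => ln; case/negP: wuni; apply/unimodalP.
(* A constant word is unimodal, with a block of n + 3 or 0 forward letters according to [b]. *)
exists i, (b * n.+3)%N; split; first by case: (b); rewrite ?mul1n.
by move=> t tn; rewrite (h t (leq_trans tn ln)); case: (b); rewrite ?mul1n ?tn.
Qed.

Lemma run_loop b i l : run w b i l -> i = i + l%:R -> l = 0%N.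
Proof.
move=> h /eqP; rewrite eq_sym -subr_eq0 addrAC subrr add0r residue_eq0 => d.
by case: l h d => // l h /(dvdn_leq (ltn0Sn _)); rewrite leqNgt (run_lt h).
Qed.

Lemma run_clash i l l' : run w true i l -> run w false i l' -> l = 0%N \/ l' = 0%N.
Proof.
case: l l' => [|l] [|l'] h h'; try by [left|right].
by have := h 0%N isT; rewrite h'.
Qed.

(** Runs in the same direction concatenate to a closed run, which has length 0; runs in opposite
    directions start at the same residue and clash there. *)
Lemma word_rel_anti i j : word_rel w i j -> word_rel w j i -> i = j.
Proof.
case/word_relP => l [] [E h] /word_relP[l' [] [E' h']].
- have /run_loop : run w true i (l + l') by apply: run_cat; rewrite -?E.
  by rewrite natrD addrA -E -E' => /(_ erefl)/eqP; rewrite addn_eq0 E => /andP[/eqP-> _]; rewrite addr0.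
- by have [] := run_clash h h'; [move=> l0; rewrite E l0 addr0|move=> l0; rewrite E' l0 addr0].
- by have [] := run_clash h' h; [move=> l0; rewrite E' l0 addr0|move=> l0; rewrite E l0 addr0].
- have /run_loop : run w false j (l + l') by apply: run_cat; rewrite -?E.
  by rewrite natrD addrA -E -E' => /(_ erefl)/eqP; rewrite addn_eq0 E => /andP[/eqP-> _]; rewrite addr0.
Qed.

Lemma word_rel_poset : is_poset (word_rel w).
Proof.
split; first exact: connect0.
by split; [exact: word_rel_anti | move=> i j k; apply: connect_trans].
Qed.

(** An arrow fails to be a cover only if its ends are also joined by a run the other way round the
    cycle. Then all other letters are opposite to this one, and the word is unimodal. *)
Lemma hasse_word : hasse (word_rel w) =2 arr w.
Proof.
move=> i j; apply/idP/idP.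
  case/hasseP => nij /connectP[[|k p] /=]; first by move=> _ E; rewrite E eqxx in nij.
  case/andP => ik kp jE /(_ k (connect1 ik)); case.
  - by apply/connectP; exists p.
  - by move=> ki; rewrite ki arr_irr in ik.
  - by move=> <-.
move=> aij; apply/hasseP; split.
- by apply: contraTneq aij => ->; rewrite arr_irr.
- exact: connect1.
move=> k ik kj; case/orP: aij => /andP[/eqP E /eqP wE]; move: (ik) (kj).
- case/word_relP => -[|l] [[kE h]|[iE h]]; try by move=> _; left; rewrite ?kE ?iE ?addr0.
    move=> _; right; apply: word_rel_anti => //; apply/word_relP; exists l; left.
    by rewrite E -addrA nat1r; split=> //; apply: run_tail.
  case/word_relP => l' [[jE h']|[kE h']].
    by have [] // := run_clash h' h; move=> l0; right; rewrite jE l0 addr0.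
  have r : run w false (i + 1) (l' + l.+1) by apply: run_cat; rewrite -E -?kE.
  have iE' : i = i + (l' + l.+1).+1%:R.
    by rewrite -nat1r addrA natrD addrA -E -kE.
  have lE : (l' + l.+1).+1 = n.+3.
    move/eqP: iE'; rewrite eq_sym -subr_eq0 addrAC subrr add0r residue_eq0 => d.
    by apply/eqP; rewrite eqn_leq (run_lt r) dvdn_leq.
  case/negP: wuni; apply/unimodalP; exists i, 1%N; split=> // -[|t] tn.
    by rewrite addr0.
  by rewrite -nat1r addrA r // -ltnS lE.
- move=> + /word_relP[] [|l] [[jE h]|[kE h]]; try by move=> _; right; rewrite ?jE ?kE ?addr0.
    case/word_relP => l' [[kE h']|[iE h']]; last first.
      by have [] // := run_clash h h'; move=> l0; left; rewrite iE l0 addr0.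
    have r : run w true (j + 1) (l' + l.+1) by apply: run_cat; rewrite -E -?kE.
    have jE' : j = j + (l' + l.+1).+1%:R.
      by rewrite -nat1r addrA natrD addrA -E -kE.
    have lE : (l' + l.+1).+1 = n.+3.
      move/eqP: jE'; rewrite eq_sym -subr_eq0 addrAC subrr add0r residue_eq0 => d.
      by apply/eqP; rewrite eqn_leq (run_lt r) dvdn_leq.
    case/negP: wuni; apply/unimodalP; exists (j + 1), n.+2; split=> // t tn.
    have [tn'|tn'] := ltnP t n.+2; first by apply: r; rewrite -ltnS lE.
    have -> : t = (l' + l.+1)%N by lia.
    by rewrite -addrA nat1r -jE' wE.
  move=> _; left; apply: word_rel_anti => //; apply/word_relP; exists l; right.
  by rewrite E -addrA nat1r; split=> //; apply: run_tail.
Qed.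

Lemma word_rel_connected : (gaps w <= 1)%N -> connected_poset (word_rel w).
Proof.
(* [a] is the gap, or 0 if there is none; the walk starts just after it and reaches every
   residue. *)
move=> g; have [a ha] : exists a, forall i, i != a -> w i != None.
  have [/eqP g0|] := posnP (gaps w).
    exists 0 => i _; apply/negP => wi; move: g0; rewrite cards_eq0 => /eqP/setP/(_ i).
    by rewrite !inE wi.
  move=> g0; have /cards1P[a aE] : gaps w == 1%N by rewrite eqn_leq g.
  by exists a => i ia; move/setP/(_ i): aE; rewrite !inE (negPf ia) => ->.
have step i : i != a -> hasse_und (word_rel w) i (i + 1).
  move=> /ha; rewrite /hasse_und !hasse_word arr_succ arr_pred.
  by case: (w i) => // -[].
have usym : connect_sym (hasse_und (word_rel w)).
  by apply: sym_connect_sym => i j; rewrite /hasse_und orbC.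
have from t : (t < n.+3)%N -> connect (hasse_und (word_rel w)) (a + 1) (a + 1 + t%:R).
  elim: t => [|t IH] tn; first by rewrite addr0 connect0.
  apply: (connect_trans (IH (ltnW tn))); apply: connect1.
  rewrite -natr1 addrA; apply: step; rewrite -addrA nat1r -subr_eq0 addrAC subrr add0r.
  by rewrite residue_eq0 gtnNdvd.
move=> i j; have [t tn ->] := residue_shift (a + 1) i; have [u un ->] := residue_shift (a + 1) j.
by apply: connect_trans (from u un); rewrite usym from.
Qed.

End Words.

Lemma connect_homo (T U : finType) (e : rel T) (e' : rel U) (f : T -> U) :
  {homo f : x y / e x y >-> e' x y} ->
  {homo f : x y / connect e x y >-> connect e' x y}.
Proof.
move=> fe x y /connectP[p]; elim: p x => [|z p IH] x /=; first by move=> _ ->; apply: connect0.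
by case/andP => /fe xz zp yE; apply: connect_trans (connect1 xz) (IH _ zp yE).
Qed.

Lemma connect_mono (T : finType) (e e' : rel T) (f : {perm T}) :
  {mono f : x y / e x y >-> e' x y} ->
  {mono f : x y / connect e x y >-> connect e' x y}.
Proof.
move=> fe x y; apply/idP/idP; last by apply: connect_homo => a b; rewrite fe.
rewrite -{2}[x](permK f) -{2}[y](permK f); apply: connect_homo => a b ab.
by rewrite -(fe (f^-1%g a)) !permKV.
Qed.

Lemma poset_iso_sym n (P Q : rel 'I_n) : poset_iso P Q -> poset_iso Q P.
Proof. by case=> s h; exists s^-1%g => i j; rewrite h !permKV. Qed.

Lemma poset_iso_trans n (P Q S : rel 'I_n) :
  poset_iso P Q -> poset_iso Q S -> poset_iso P S.
Proof. by case=> s h [s' h']; exists (s * s')%g => i j; rewrite h h' !permM. Qed.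

(** Place the elements on the cycle in the order of the enumeration. All consecutive pairs are Hasse
    edges except perhaps the closing one, so there is at most one gap. *)
Lemma nnegA_word n (P : rel 'I_n.+3) : nnegA P ->
  exists w : word n, good_word w /\ poset_iso P (word_rel w).
Proof.
move=> PA; have [N [s [t Pline]]] := nnegA_line PA.
case: (PA) => Pposet Pconn _ _; pose e := hasse_und P.
have hasse_irr : irreflexive (hasse P) by move=> i; rewrite /hasse eqxx.
have [] := @path_enumeration _ e _ Pconn _ ord0.
- by move=> i j; rewrite /e /hasse_und orbC.
- exact: line_hasse_degree Pposet _ _ _ Pline.
move=> l [lu lall lnext lonly].
have szl : size l = n.+3.
  rewrite -(card_uniqP lu) -[RHS]card_ord; apply: eq_card => i.
  by rewrite lall.
pose f (i : 'I_n.+3) := nth ord0 l i.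
have f_inj : injective f.
  by move=> i j /eqP; rewrite nth_uniq ?szl // => /eqP/val_inj.
pose q := perm f_inj.
have val_succ (i : 'I_n.+3) : (i + 1 : 'I_n.+3) = (if (i.+1 < n.+3)%N then i.+1 else 0)%N :> nat.
  have -> : i + 1 = i.+1%:R by rewrite -natr1 residue_val.
  rewrite val_residue; case: ltnP => il; first by rewrite modn_small.
  by have -> : i.+1 = n.+3; [have := ltn_ord i; lia | rewrite modnn].
have adj i j : e (f i) (f j) -> j = i + 1 \/ i = j + 1.
  have adj' (a b : 'I_n.+3) : (a < b)%N -> e (f a) (f b) -> b = a + 1 \/ a = b + 1.
    move=> ab eab; have [|E|[a0 E]] := lonly a b _ eab.
    - by rewrite ab szl ltn_ord.
    - by left; apply: ord_inj; rewrite val_succ -E ltn_ord.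
    - by right; apply: ord_inj; rewrite val_succ E szl ltnn a0.
  move=> eij; case: (ltngtP i j) => ij; first exact: adj'.
    by have [] := adj' j i ij; rewrite /e /hasse_und 1?orbC //; [right|left].
  by move: eij; rewrite (val_inj ij) /e /hasse_und hasse_irr.
pose w : word n := [ffun i => if hasse P (f i) (f (i + 1)) then Some true else
  if hasse P (f (i + 1)) (f i) then Some false else None].
have hasse_asym a b : hasse P a b -> hasse P b a -> False.
  case/hasseP => ab Pab _ /hasseP[_ Pba _].
  by case: Pposet => _ [anti _]; rewrite (anti _ _ Pab Pba) eqxx in ab.
have arrE i j : arr w i j = hasse P (f i) (f j).
  apply/idP/idP.
    case/orP => /andP[/eqP -> /eqP]; by rewrite ffunE; case: ifP => // _; case: ifP.
  move=> hij; have eij : e (f i) (f j) by rewrite /e /hasse_und hij.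
  have [E|E] := adj _ _ eij.
    by rewrite E arr_succ ffunE -E hij.
  rewrite E in hij *; rewrite arr_pred ffunE hij; case: ifP => // hji.
  by case: (hasse_asym _ _ hij hji).
have Pw i j : word_rel w i j = P (f i) (f j).
  rewrite (poset_connect_hasse Pposet).
  rewrite -[f i](permE f_inj) -[f j](permE f_inj); apply/esym/connect_mono => a b.
  by rewrite !permE arrE.
exists w; split; last first.
  by apply: poset_iso_sym; exists q => i j; rewrite Pw !permE.
apply/andP; split.
  rewrite -(cards1 (ord_max : 'I_n.+3)); apply: subset_leq_card.
  apply/subsetP => i; rewrite !inE; apply: contraTT => imax.
  have il : (i.+1 < n.+3)%N.
    by move: imax; rewrite -val_eqE /=; have := ltn_ord i; lia.
  have := lnext i; rewrite szl => /(_ il).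
  have -> : nth ord0 l i.+1 = f (i + 1) by rewrite /f val_succ il.
  by rewrite -/(f i) ffunE /e /hasse_und; do ?case: ifP.
apply/negP => /unimodalP[i [k [kn hw]]].
have up a : w a = Some true -> hasse P (f a) (f (a + 1)) by rewrite -arrE arr_succ => ->.
have down a : w a = Some false -> hasse P (f (a + 1)) (f a) by rewrite -arrE arr_pred => ->.
have runs b a m : run w b a m -> if b then P (f a) (f (a + m%:R)) else P (f (a + m%:R)) (f a).
  by move=> h; case: b h => h; rewrite -Pw; apply/word_relP; exists m; [left|right].
have anti a b : P a b -> P b a -> a = b by case: Pposet => _ [h _]; apply: h.
(* In a unimodal word either all letters agree, and the oriented cycle contradicts antisymmetry, or
   the source at [i] has two covers below the single sink at i + k, which is a forbidden diamond. *)
have close (a : 'I_n.+3) : a + 1 + n.+2%:R = a by rewrite -addrA nat1r residue_full addr0.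
have no_const b : ~ (forall a, w a = Some b).
  move=> wb; have := runs b (i + 1) n.+2 (fun _ _ => wb _); rewrite close => r.
  have : f i = f (i + 1).
    by case: b wb r => wb r; [have /hasseP[_ h _] := up i (wb _)|have /hasseP[_ h _] := down i (wb _)]; apply: anti.
  by move/f_inj/esym/eqP; rewrite (negPf (addr1_neq i)).
have all_t b : (forall t, (t < n.+3)%N -> w (i + t%:R) = Some b) -> False.
  by move=> h; apply: (no_const b) => a; have [u un ->] := residue_shift i a; apply: h.
have [k0|k0] := posnP k; first by apply: (all_t false) => u un; rewrite hw // k0.
have [kE|kn'] := eqVneq k n.+3; first by apply: (all_t true) => u un; rewrite hw // kE un.
have kn2 : (k <= n.+2)%N by lia.
have iE : i = i + n.+2%:R + 1 by rewrite addrAC close.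
apply: (line_no_diamond Pposet Pline (i := f i) (a := f (i + 1)) (b := f (i + n.+2%:R)) (m := f (i + k%:R))).
- by apply: up; have := hw 0%N isT; rewrite addr0 k0.
- by rewrite {1}iE; apply: down; rewrite hw // ltnNge kn2.
- rewrite (inj_eq f_inj); apply/eqP => /addrI/eqP.
  rewrite -subr_eq0 -[n.+2%:R](addrK (1 : 'I_n.+3)) natr1 residue_full sub0r opprK (residue_eq0 n 2).
  by rewrite gtnNdvd.
- have := runs true (i + 1) k.-1; rewrite -addrA nat1r prednK //; apply=> u uk.
  by rewrite -addrA nat1r hw; [congr Some|]; lia.
- have := runs false (i + k%:R) (n.+2 - k)%N; rewrite -addrA -natrD subnKC //; apply=> u uk.
  by rewrite -addrA -natrD hw; [congr Some|]; lia.
Qed.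

(** * Roots attached to monotone runs *)

Section Runs.
Variable c : nat -> bool.

Fixpoint run_start (i : nat) : nat :=
  if i is j.+1 then (if c i == c j then run_start j else i) else 0.
Local Notation p := run_start.

Lemma run_start_le i : (p i <= i)%N.
Proof. by elim: i => //= i IH; case: ifP => // _; apply: leqW. Qed.

Lemma run_start_const i t : (p i <= t <= i)%N -> c t = c i.
Proof.
elim: i t => [|i IH] t /=; first by rewrite leqn0 => /eqP->.
have [E|E] := eqVneq (c i.+1) (c i); last by rewrite -eqn_leq => /eqP->.
by case/andP=> pt; rewrite leq_eqVlt => /predU1P[->//|ti]; rewrite E IH // pt.
Qed.

Lemma run_start_turn i : (0 < p i)%N -> c (p i).-1 != c (p i).
Proof.
by elim: i => //= i IH; have [E|E] := eqVneq (c i.+1) (c i); rewrite //= eq_sym.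
Qed.

Lemma run_start_leP a i : (a <= i)%N ->
  reflect (forall t, (a <= t <= i)%N -> c t = c i) (p i <= a)%N.
Proof.
move=> ai; apply: (iffP idP) => [pa t /andP[at_ ti]|h].
  by apply: run_start_const; rewrite ti (leq_trans pa).
rewrite leqNgt; apply/negP => ap; have pi := run_start_le i.
have := @run_start_turn i; rewrite (leq_ltn_trans _ ap) // => /(_ isT).
by rewrite !h ?eqxx //; lia.
Qed.

(* [run_root m i] is the root [+-(e_p - e_(i+1))] attached to the [i]th vertex,
   where [p] is the start of the run through [i]; the coordinate [i + 1] is read
   modulo [m + 1], which closes up the cycle at [i = m]. *)
Definition run_root (m i v : nat) : int :=
  (-1) ^+ c i * ((v == p i)%:R - (v == (i.+1 %% m.+1)%N)%:R).

Lemma run_root_dot m i j : (i <= m)%N -> (j <= m)%N ->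
  \sum_(v < m.+1) run_root m i v * run_root m j v =
  (-1) ^+ (c i (+) c j) * ((p i == p j)%:R + ((i.+1 %% m.+1)%N == (j.+1 %% m.+1)%N)%:R
    - (p i == (j.+1 %% m.+1)%N)%:R - ((i.+1 %% m.+1)%N == p j)%:R).
Proof.
move=> im jm; have E (a : nat) (F : nat -> int) : (a < m.+1)%N ->
   \sum_(v < m.+1) (v == a :> nat)%:R * F v = F a.
  by move=> la; rewrite (sum_delta (fun v : 'I_m.+1 => F v) la).
under eq_bigr do rewrite /run_root mulrACA -signr_addb.
rewrite -mulr_sumr; congr (_ * _).
under eq_bigr do rewrite mulrBl; rewrite sumrB.
rewrite (E _ (fun v => (v == p j)%:R - (v == (j.+1 %% m.+1)%N)%:R)); last first.
  by rewrite ltnS (leq_trans (run_start_le i)).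
rewrite (E _ (fun v => (v == p j)%:R - (v == (j.+1 %% m.+1)%N)%:R)) ?ltn_mod //.
by ring.
Qed.

End Runs.

Section RealizeRuns.
Variables (n m : nat) (P : rel 'I_n) (c : nat -> bool).
Variables (pos : 'I_n -> nat) (elt : 'I_m -> 'I_n).
Local Notation p := (run_start c).
Hypothesis Pposet : is_poset P.
Hypothesis pos_le : forall i, (pos i <= m)%N.
Hypothesis pos_inj : injective pos.
Hypothesis eltK : forall j, pos (elt j) = j.
(** The letter [c u] joins the positions u - 1 and u, so the letters from one element to a later one
    have indices from [(pos i).+1] to [pos j]. An element at position m, present only on a closed
    cycle, can also be reached through the letter 0. *)
Hypothesis Pshort : forall i j, (pos i < pos j)%N -> (pos j < m)%N ->
  (P i j || P j i) = (p (pos j) <= (pos i).+1)%N.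
Hypothesis Plast : forall i j, (pos i < pos j)%N -> pos j = m ->
  (P i j || P j i) = (p m <= (pos i).+1)%N || (p (pos i) == 0)%N.
(** Position m is a turning point, and the last run does not directly follow the first. The number
    of runs is then even and at least four: the cycle has at least two sinks. *)
Hypothesis turn_last : forall i, pos i = m -> [/\ p m != 0%N, c m != c 0%N & p (p m).-1 != 0%N].

Let Y : 'M[int]_(n, m.+1) := \matrix_(i, v) run_root c m (pos i) v.
Let X := Y *m cummx m.

Let YE : X *m rootmx m = Y.
Proof.
apply: cum_diff => i; under eq_bigr do rewrite mxE.
rewrite -mulr_sumr sumrB; apply/eqP; rewrite mulf_eq0; apply/orP; right.
have sum1 a : (a < m.+1)%N -> \sum_(v < m.+1) (v == a :> nat)%:R = 1 :> int.
  by move=> la; under eq_bigr do rewrite -[_%:R]mulr1; rewrite (sum_delta _ la).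
rewrite !sum1 ?subrr ?ltn_mod // ltnS (leq_trans (run_start_le _ _)) //.
Qed.

(** Roots of one run agree in sign and in the coordinate of its start. If the run of [j] starts at
    [(pos i).+1], that coordinate occurs with opposite signs but the letters differ as well, so the
    product is again 1. At position m the coordinate 0 also meets the roots of the first run. *)
Let gram_lt i j : (pos i < pos j)%N ->
  (P i j || P j i)%:R = \sum_(v < m.+1) run_root c m (pos i) v * run_root c m (pos j) v.
Proof.
move=> ij; rewrite run_root_dot // (@modn_small (pos i).+1); last first.
  by rewrite ltnS (leq_trans ij).
have hi := run_start_le c (pos i); have hj := run_start_le c (pos j).
have split_ : (p (pos j) <= pos i)%N -> p (pos j) = p (pos i) /\ c (pos j) = c (pos i).
  move=> h; have ci : c (pos i) = c (pos j) by apply: run_start_const; lia.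
  split=> //; apply/eqP; rewrite eqn_leq; apply/andP; split.
    apply/run_start_leP; first by lia.
    move=> t /andP[t1 t2]; have [ti|ti] := leqP t (pos i).
      by rewrite -ci; apply: run_start_const; lia.
    by apply: run_start_const; lia.
  apply/run_start_leP => // t /andP[t1 t2].
  by rewrite ci; apply: run_start_const; lia.
have next : p (pos j) = (pos i).+1 -> c (pos i) != c (pos j).
  move=> h; have := @run_start_turn c (pos j); rewrite h => /(_ isT) /=.
  by rewrite (@run_start_const c (pos j) (pos i).+1) // h leqnn.
have [jm|jm] := ltnP (pos j) m.
  rewrite Pshort // modn_small //.
  have -> : (p (pos i) == (pos j).+1) = false by lia.
  have -> : ((pos i).+1 == (pos j).+1) = false by lia.
  case: (ltngtP (p (pos j)) (pos i).+1) => [h|h|h].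
  - by have [-> ->] := split_ h; rewrite eqxx addbb.
  - have -> : (p (pos i) == p (pos j)) = false by lia.
    by rewrite mulr0.
  - have -> : (p (pos i) == p (pos j)) = false by lia.
    by have := next h; case: (c _); case: (c _).
have {}jm : pos j = m by apply/eqP; rewrite eqn_leq pos_le.
have [pm0 cm0 ppm] := turn_last jm.
rewrite Plast // jm modnn; rewrite jm in ij hj split_ next.
have -> : ((pos i).+1 == 0)%N = false by [].
have [pi0|pi0] := eqVneq (p (pos i)) 0%N.
  have -> : ((pos i).+1 == p m) = false.
    by apply: contraNF ppm => /eqP <-; rewrite pi0.
  rewrite pi0 [(0 == p m)%N]eq_sym (negPf pm0) orbT.
  have <- : c 0%N = c (pos i) by apply: run_start_const; rewrite pi0.
  by move: cm0; case: (c _); case: (c _).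
rewrite orbF; case: (ltngtP (p m) (pos i).+1) => [h|h|h].
- by have [-> ->] := split_ h; rewrite eqxx addbb.
- have -> : (p (pos i) == p m) = false by lia.
  by rewrite mulr0.
- have -> : (p (pos i) == p m) = false by lia.
  by have := next h; case: (c _); case: (c _).
Qed.

Lemma runs_realize : nonneg P /\ dyn_is_A P.
Proof.
have [Prefl [Panti _]] := Pposet.
have Xgram i j :
  (P i j)%:R + (P j i)%:R = (X *m rootmx m *m (X *m rootmx m)^T) i j.
  rewrite YE mxE; under eq_bigr do rewrite !mxE.
  have sum_or (a b : 'I_n) : a != b -> (P a b)%:R + (P b a)%:R = (P a b || P b a)%:R :> int.
    move=> ab; have := Panti a b; case: (P a b); case: (P b a) => //= /(_ isT isT) E.
    by rewrite E eqxx in ab.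
  case: (ltngtP (pos i) (pos j)) => [ij|ij|/pos_inj ->].
  - by rewrite sum_or ?gram_lt //; apply: contraTneq ij => ->; rewrite ltnn.
  - rewrite addrC sum_or ?gram_lt //; last by apply: contraTneq ij => ->; rewrite ltnn.
    by apply: eq_bigr => v _; rewrite mulrC.
  rewrite run_root_dot // Prefl addbb !eqxx.
  have hj := run_start_le c (pos j).
  suff /negPf nq : p (pos j) != ((pos j).+1 %% m.+1)%N by rewrite [(_ == p _)]eq_sym nq.
  have [jm|jm] := ltnP (pos j) m; first by rewrite modn_small //; lia.
  have {}jm : pos j = m by apply/eqP; rewrite eqn_leq pos_le.
  by rewrite jm modnn; have [] := turn_last jm.
(* In the simple roots, the root at position i is up to sign the sum of those with index from p i to
   i. Leaving out position m makes the matrix triangular with diagonal entries 1 or -1. *)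
have Xunit : rowsub elt X \in unitmx.
  have E i k : rowsub elt X i k =
     (-1) ^+ c i * ((p i <= k)%N%:R - (i.+1 <= k)%N%:R).
    rewrite !mxE; under eq_bigr do rewrite !mxE eltK -mulrA mulrBl.
    rewrite -mulr_sumr sumrB (modn_small (ltn_ord i : (i.+1 < m.+1)%N)).
    rewrite (sum_delta _ (a := p i)); first by rewrite ltnS (leq_trans (run_start_le _ _)) // ltnW.
    by move=> h1; rewrite (sum_delta _ (a := i.+1)) //=; rewrite ltnS.
  rewrite unitmxE det_trig; last first.
    apply/is_trig_mxP => i k ik; rewrite E ik.
    by rewrite (leq_trans (run_start_le _ _)) ?subrr ?mulr0 // ltnW.
  apply: rpred_prod => i _; rewrite E run_start_le ltnn subr0 mulr1.
  by case: (c i).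
split; first exact: realized_nonneg Xgram.
apply: realized_dyn_is_A Xgram _ Xunit => i j E.
by apply: ord_inj; rewrite -(eltK i) -(eltK j) E.
Qed.

End RealizeRuns.

(** * Cutting a good word open at an anchor *)

Section GoodWord.
Variables (n : nat) (w : word n).
Hypothesis wuni : ~~ unimodal w.
Implicit Types i j : 'I_n.+3.
Variables (a : 'I_n.+3) (m : nat).
Hypothesis filled : forall u, (0 < u < n.+3)%N -> w (a + u%:R) <> None.
(** Either [a] is the gap and all elements have positions below m, or the vertex [a], which gets
    position m, is a turning point of a full cycle and is the element to be deleted. *)
Hypothesis closing : m = n.+3 /\ w a = None \/
  [/\ m = n.+2, w a <> None & w (a + n.+2%:R) <> w a].

(** Among the indices below n + 3 a gap can occur only at 0, where it is read as [false];
    comparabilities along the path use positive indices only. *)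
Let c t := w (a + t%:R) == Some true.
Let pos i : nat := nat_of_ord (i - (a + 1)).
Let elt (k : 'I_m) : 'I_n.+3 := a + k.+1%:R.
Local Notation p := (run_start c).

Let posE i : i = a + (pos i).+1%:R.
Proof. by rewrite -nat1r addrA residue_val addrC subrK. Qed.

Let pos_lt i : (pos i < n.+3)%N. Proof. exact: ltn_ord. Qed.

Let c_some u : (0 < u < n.+3)%N -> w (a + u%:R) = Some (c u).
Proof. by move=> /filled; rewrite /c; case: (w _) => // -[]. Qed.

Let c_wrap u : w (a + (n.+3 + u)%:R) = w (a + u%:R).
Proof. by rewrite natrD residue_full add0r. Qed.

Let shift_pos i j l : (l < n.+3)%N -> j = i + l%:R ->
  (pos i + l = pos j \/ pos i + l = n.+3 + pos j)%N.
Proof.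
move=> ln jE; have E : (pos i + l)%:R = (pos j)%:R :> 'I_n.+3.
  by rewrite natrD !residue_val jE addrAC.
have {E} /(congr1 (@nat_of_ord _)) := E; rewrite !val_residue [RHS]modn_small //.
have [h|h] := ltnP (pos i + l) n.+3; first by rewrite modn_small //; left.
rewrite -(subnK h) modnDr modn_small; last by have := pos_lt i; lia.
by move=> <-; right; rewrite addnC.
Qed.

(** A run joining the two elements either stays between their positions or starts at the later one
    and passes over the anchor. *)
Let comparable i j : (pos i < pos j)%N ->
  reflect (exists b, run w b i (pos j - pos i) \/ run w b j (n.+3 + pos i - pos j))
    (word_rel w i j || word_rel w j i).
Proof.
move=> ij; have hi := pos_lt i; have hj := pos_lt j.
have fwd x y b l : run w b x l -> y = x + l%:R -> x = i /\ y = j \/ x = j /\ y = i ->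
    exists b, run w b i (pos j - pos i) \/ run w b j (n.+3 + pos i - pos j).
  move=> r yE h; exists b; have := shift_pos (run_lt wuni r) yE; have := run_lt wuni r.
  case: h => -[xE y'E] ln hl; rewrite xE y'E in r hl; [left|right].
    by have -> : (pos j - pos i = l)%N by lia.
  by have -> : (n.+3 + pos i - pos j = l)%N by lia.
apply: (iffP orP) => [[]/word_relP[l [] [E r]]|[b hb]].
- by apply: fwd r E _; left.
- by apply: fwd r E _; right.
- by apply: fwd r E _; right.
- by apply: fwd r E _; left.
suff [l [[E r]|[E r]]] : exists l, (j = i + l%:R /\ run w b i l) \/ (i = j + l%:R /\ run w b j l).
- by case: b r {hb} => r; [left|right]; apply/word_relP; exists l; [left|right].
- by case: b r {hb} => r; [right|left]; apply/word_relP; exists l; [left|right].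
case: hb => r; eexists; [left|right]; split; try exact: r.
  by rewrite {1}[j]posE {1}[i]posE -addrA -natrD; congr (_ + _%:R); lia.
rewrite {1}[j]posE {1}[i]posE -addrA -natrD.
have -> : ((pos j).+1 + (n.+3 + pos i - pos j) = n.+3 + (pos i).+1)%N by lia.
by rewrite natrD residue_full add0r.
Qed.

Let run_pos b i l : run w b i l <->
  forall u, (pos i < u <= pos i + l)%N -> w (a + u%:R) = Some b.
Proof.
split=> h u; last first.
  by move=> ul; rewrite {1}[i]posE -addrA -natrD h //; lia.
move=> /andP[u1 u2]; have := h (u - (pos i).+1)%N; rewrite [X in w (X + _)]posE -addrA -natrD subnKC //.
by apply; lia.
Qed.

Let short_run i j : (pos i < pos j)%N ->
  (exists b, run w b i (pos j - pos i)) <-> (p (pos j) <= (pos i).+1)%N.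
Proof.
move=> ij; have hj := pos_lt j; split.
  case=> b /run_pos h; apply/run_start_leP => // t /andP[t1 t2].
  by rewrite /c !h //; lia.
move=> /run_start_leP h; exists (c (pos j)); apply/run_pos => u hu.
by rewrite c_some ?h //; lia.
Qed.

Lemma anchored_word_realized : nonneg (word_rel w) /\ dyn_is_A (word_rel w).
Proof.
have ub b u : w (a + u%:R) = Some b -> c u = b by rewrite /c => ->; case: (b).
have m2 : (n.+2 <= m <= n.+3)%N by case: closing => [[-> _]|[-> _ _]]; lia.
apply: (@runs_realize _ m _ c pos elt).
- exact: word_rel_poset.
- move=> i; have := pos_lt i; case: closing => [[-> _]|[-> _ _]]; lia.
- by move=> i j E; rewrite [i]posE [j]posE E.
- move=> k; have := ltn_ord k => km.
  by rewrite /pos /elt -nat1r opprD addrACA subrr add0r addrAC subrr add0r val_residue modn_small //; lia.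
- move=> i j ij jm; have hj := pos_lt j; apply/comparable/idP => //.
    case=> b [] h; first by apply/short_run => //; exists b.
    (* A run over the anchor from a position below m uses the letter at [a] and, when m = n + 2,
       also the one before it. The former may be a gap; otherwise the two differ. *)
    move/run_pos: h => h; have := h n.+3; have := h n.+2.
    rewrite residue_full addr0 => h1 h2.
    case: closing => [[_ wa]|[mE wa wa2]]; first by rewrite h2 in wa; [|lia].
    by case: wa2; rewrite h1 ?h2 //; lia.
  by move=> /short_run -/(_ ij)[b hb]; exists b; left.
- move=> i j ij jm; have hj := pos_lt j; have mE : m = n.+2 by case: closing => [[]|[]]; lia.
  rewrite -{1}jm; apply/comparable/orP => //.
    case=> b [] h; first by left; apply/short_run => //; exists b.
    move/run_pos: h => h; right; rewrite -leqn0; apply/run_start_leP => // t /andP[_ t2].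
    by rewrite !(ub b) // -c_wrap h //; lia.
  case=> [/short_run -/(_ ij)[b hb]|]; first by exists b; left.
  rewrite -leqn0 => /run_start_leP -/(_ isT) h; exists (c (pos i)); right; apply/run_pos => u hu.
  have -> : u = (n.+3 + (u - n.+3))%N by lia.
  have -> : c (pos i) = c (u - n.+3)%N by rewrite h //; lia.
  rewrite c_wrap; have [u0|u0] := posnP (u - n.+3); last by rewrite c_some //; lia.
  case: closing => [[]|[_ wa _]]; first by lia.
  by rewrite u0 /c addr0; case: (w a) wa => // -[].
move=> i im; have hi := pos_lt i.
case: closing => [[mE _]|[mE wa wa2]]; first by lia.
have cs u : (u < n.+3)%N -> w (a + u%:R) = Some (c u).
  case: u => [_|u hu]; last exact: c_some.
  by rewrite /c addr0; case: (w a) wa => // -[].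
have cm0 : c m != c 0%N.
  apply/eqP => E; apply: wa2; rewrite -[in RHS](addr0 a) -[0]/(0%:R) !cs //.
  by rewrite -E mE.
split=> //.
  apply: contraNneq cm0 => pm; apply/eqP/esym; apply: run_start_const.
  by rewrite pm.
(* If the last run directly followed the first, the word would consist of two blocks; the forward
   block starts at p m or at 0, depending on [c m]. *)
apply: contraNneq wuni => pp; apply/unimodalP.
have pm := run_start_le c m.
have pm0 : (0 < p m)%N.
  rewrite lt0n; apply: contraNneq cm0 => p0; apply/eqP/esym; apply: run_start_const.
  by rewrite p0.
have turn := run_start_turn pm0.
have hi1 u : (p m <= u <= m)%N -> c u = c m by apply: run_start_const.
have lo u : (u < p m)%N -> c u = ~~ c m.
  move=> hu; have -> : c u = c (p m).-1.
    by apply: run_start_const; rewrite pp /= -ltnS prednK.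
  by move: turn; rewrite [c (p m)]hi1 ?leqnn ?pm //; case: (c _); case: (c _).
case cmE : (c m) in hi1 lo.
  exists (a + (p m)%:R), (n.+3 - p m)%N; split; first by lia.
  move=> t tn; rewrite -addrA -natrD; have [h|h] := ltnP t (n.+3 - p m).
    by rewrite cs ?hi1 //; lia.
  have -> : (p m + t = n.+3 + (p m + t - n.+3))%N by lia.
  by rewrite c_wrap cs ?lo //; lia.
exists a, (p m); split; first by lia.
move=> t tn; rewrite cs //; have [h|h] := ltnP t (p m); first by rewrite lo.
by rewrite hi1 //; lia.
Qed.

End GoodWord.

Lemma good_word_nnegA n (w : word n) : good_word w -> nnegA (word_rel w).
Proof.
case/andP => g wuni.
(* The anchor is the gap or, in a gapless word, any turning point; without turning points the word
   is constant, hence unimodal. *)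
suff [a [m [h1 h2]]] : exists a m, (forall u, (0 < u < n.+3)%N -> w (a + u%:R) <> None) /\
    (m = n.+3 /\ w a = None \/ [/\ m = n.+2, w a <> None & w (a + n.+2%:R) <> w a]).
  have [? ?] := anchored_word_realized wuni h1 h2.
  by split=> //; [exact: word_rel_poset | exact: word_rel_connected].
have [/eqP|g0] := posnP (gaps w).
  rewrite cards_eq0 => /eqP/setP w0.
  have wN i : w i <> None by move=> E; have := w0 i; rewrite !inE E.
  case: (boolP [exists a, w (a + n.+2%:R) != w a]) => [/existsP[a /eqP wa]|/existsPn h].
    by exists a, n.+2; split=> //; right.
  have wc t : w t%:R = w 0.
    elim: t => // t <-; have := h t.+1%:R; rewrite negbK => /eqP <-.
    by rewrite -nat1r addrAC nat1r residue_full add0r.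
  case/negP: wuni; apply/unimodalP; case E : (w 0) => [b|]; last by case: (wN 0).
  exists 0, (b * n.+3)%N; split; first by case: (b); rewrite ?mul1n.
  by move=> t tn; rewrite add0r wc E; case: (b); rewrite ?mul1n ?tn.
have /cards1P[a aE] : gaps w == 1%N by rewrite eqn_leq g.
have wa i : (w i == None) = (i == a) by move/setP/(_ i): aE; rewrite !inE.
exists a, n.+3; split; last by left; split=> //; apply/eqP; rewrite wa.
move=> u un /eqP; rewrite wa -subr_eq0 addrAC subrr add0r residue_eq0 gtnNdvd //; lia.
Qed.

(** A chain is a single run; with as many positions below m as elements nothing is deleted. *)
Lemma chain_nnegA n : (n < 2)%N -> nnegA (fun i j : 'I_n.+1 => (i <= j)%N).
Proof.
move=> n2; have Pposet : is_poset (fun i j : 'I_n.+1 => (i <= j)%N).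
  split; first by move=> i.
  split; last by move=> i j k; apply: leq_trans.
  by move=> i j ij ji; apply: ord_inj; apply/eqP; rewrite eqn_leq ij.
have p0 i : run_start (fun=> true) i = 0%N by elim: i => //= i ->.
have [nn dA] : nonneg (fun i j : 'I_n.+1 => (i <= j)%N) /\ dyn_is_A (fun i j : 'I_n.+1 => (i <= j)%N).
  apply: (@runs_realize n.+1 n.+1 _ (fun=> true) (@nat_of_ord n.+1) id Pposet) => //.
  - by move=> i; apply: ltnW.
  - exact: ord_inj.
  - by move=> i j ij _; rewrite p0 (ltnW ij).
  - by move=> i j ij jn; have := ltn_ord j; rewrite jn ltnn.
  - by move=> i iE; have := ltn_ord i; rewrite iE ltnn.
split=> //; case: n n2 {Pposet nn dA p0} => [|[|//]] _ i j.
  by rewrite (ord1 i) (ord1 j) connect0.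
have h (a b : 'I_2) : a != b -> hasse_und (fun i j : 'I_2 => (i <= j)%N) a b.
  have k3 (x y : 'I_2) : x != y -> [exists k, [&& k != x, k != y, (x <= k)%N & (k <= y)%N]] = false.
    by move=> xy; apply/existsP => -[k /and4P[]]; move: k x y xy => [[|[|?]] ?] [[|[|?]] ?] [[|[|?]] ?].
  move=> ab; have ba : b != a by rewrite eq_sym.
  rewrite /hasse_und /hasse (k3 a b ab) (k3 b a ba) ab ba /= !andbT.
  exact: leq_total.
by have [->|ij] := eqVneq i j; [apply: connect0 | apply: connect1; apply: h].
Qed.

(** * The dihedral action on words *)

(* The rotation and reflection act on the edges of the cycle; on its vertices
   they are [i |-> i + k] and [i |-> k + 1 - i]. *)
Definition dihedral n (x : bool * 'I_n.+3) (w : word n) : word n :=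
  if x.1 then [ffun i => omap negb (w (x.2 - i))] else [ffun i => w (i + x.2)].

Lemma hasse_iso n (P Q : rel 'I_n) (s : {perm 'I_n}) :
  {mono s : i j / P i j >-> Q i j} -> {mono s : i j / hasse P i j >-> hasse Q i j}.
Proof.
move=> h i j; rewrite /hasse (inj_eq perm_inj) h; congr [&& _, _ & ~~ _].
apply/existsP/existsP => -[k hk]; last by exists (s k); rewrite !(inj_eq perm_inj) !h.
by exists (s^-1%g k); move: hk; rewrite -{1 2 3 4}[k](permKV s) !(inj_eq perm_inj) !h.
Qed.

Section DihedralWords.
Variable n : nat.
Implicit Types (w : word n) (i j k : 'I_n.+3).

Lemma dihedral_word_rel x w : poset_iso (word_rel (dihedral x w)) (word_rel w).
Proof.
case: x => -[] k.
  have f_inj : injective (fun i => k + 1 - i) by move=> i j /addrI/oppr_inj.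
  exists (perm f_inj) => i j; apply/esym/connect_mono => a b; rewrite !permE.
  have E x y : (k + 1 - y == k + 1 - x + 1) = (x == y + 1).
    by rewrite -[RHS]subr_eq0 -subr_eq0; congr (_ == 0); ring.
  rewrite /arr !E /dihedral /= !ffunE orbC.
  congr (_ || _); apply: andb_id2l => /eqP ->.
    have -> : k + 1 - (a + 1) = k - a by ring.
    by case: (w _) => // -[].
  have -> : k + 1 - (b + 1) = k - b by ring.
  by case: (w _) => // -[].
have f_inj : injective (fun i => i + k) by move=> i j /addIr.
exists (perm f_inj) => i j; apply/esym/connect_mono => a b; rewrite !permE.
by rewrite /arr /dihedral /= !ffunE ![_ + k + 1]addrAC !(inj_eq (addIr k)).
Qed.

Lemma gaps_dihedral x w : gaps (dihedral x w) = gaps w.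
Proof.
case: x => e k; pose f i := if e then k - i else i + k.
have f_inj : injective f by rewrite /f; case: (e) => i j; [move/addrI/oppr_inj | move/addIr].
rewrite /gaps -(card_imset _ f_inj); congr #|pred_of_set _|; apply/setP => i.
have -> : i = f (if e then k - i else i - k).
  by rewrite /f; case: (e); rewrite ?subKr ?subrK.
rewrite mem_imset // !inE /dihedral /f; case: (e) => /=; rewrite !ffunE ?subKr //.
by case: (w _).
Qed.

Lemma unimodal_dihedral_sub x w : unimodal w -> unimodal (dihedral x w).
Proof.
case/unimodalP => i [l [ln h]]; apply/unimodalP; case: x => -[] k.
  (* Reflection reverses the order and negates the letters, so the former backward block becomes the
     forward one. *)
  exists (k - i + 1), (n.+3 - l)%N; split; first exact: leq_subr.
  move=> t tn; rewrite /dihedral ffunE /=.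
  have -> : k - (k - i + 1 + t%:R) = i + (n.+2 - t)%:R.
    rewrite natrB; last by rewrite -ltnS.
    have -> : n.+2%:R = -1 :> 'I_n.+3 by apply/eqP; rewrite -subr_eq0 opprK natr1 residue_full.
    by ring.
  by rewrite h //=; [congr Some|]; lia.
exists (i - k), l; split=> // t tn; rewrite /dihedral ffunE /=.
by rewrite -(h t tn); congr (w _); ring.
Qed.

Lemma dihedral_comp x y :
  exists z, forall w, dihedral y (dihedral x w) = dihedral z w.
Proof.
case: x y => [[] k] [[] l].
- exists (false, k - l) => w; apply/ffunP => i; rewrite /dihedral /= !ffunE.
  have -> : k - (l - i) = i + (k - l) by ring.
  by case: (w _) => // -[].
- exists (true, k - l) => w; apply/ffunP => i; rewrite /dihedral /= !ffunE.
  by have -> : k - (i + l) = k - l - i by ring.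
- exists (true, k + l) => w; apply/ffunP => i; rewrite /dihedral /= !ffunE.
  by have -> : l - i + k = k + l - i by ring.
- exists (false, k + l) => w; apply/ffunP => i; rewrite /dihedral /= !ffunE.
  by have -> : i + l + k = i + (k + l) by ring.
Qed.

Lemma dihedral1 w : dihedral (false, 0) w = w.
Proof. by apply/ffunP => i; rewrite ffunE addr0. Qed.

Lemma dihedral_inv x : exists y, cancel (@dihedral n x) (dihedral y).
Proof.
case: x => -[] k.
  exists (true, k) => w; apply/ffunP => i; rewrite /dihedral /= !ffunE subKr.
  by case: (w _) => // -[].
by exists (false, - k) => w; apply/ffunP => i; rewrite /dihedral /= !ffunE subrK.
Qed.

Lemma dihedral_inj x : injective (@dihedral n x).
Proof. by have [y /can_inj] := dihedral_inv x. Qed.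

Lemma unimodal_dihedral x w : unimodal (dihedral x w) = unimodal w.
Proof.
apply/idP/idP; last exact: unimodal_dihedral_sub.
by have [y xy] := dihedral_inv x => /(@unimodal_dihedral_sub y); rewrite xy.
Qed.

(** An isomorphism preserves covers, so it sends consecutive residues to neighbours, except possibly
    across the gap. Injectivity forbids turning back, hence it is affine of slope 1 or -1. *)
Lemma word_rel_iso w w' : good_word w -> good_word w' ->
  poset_iso (word_rel w) (word_rel w') -> exists x, w = dihedral x w'.
Proof.
move=> /andP[g wuni] /andP[_ wuni'] [s hs].
have arrE i j : arr w' (s i) (s j) = arr w i j.
  rewrite -!hasse_word //; apply: (hasse_iso (P := word_rel w)) => a b.
  by rewrite hs.
have [a ha] : exists a, forall i, i != a -> w i != None.
  have [/eqP g0|] := posnP (gaps w).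
    exists 0 => i _; apply/negP => wi; move: g0; rewrite cards_eq0 => /eqP/setP/(_ i).
    by rewrite !inE wi.
  move=> g0; have /cards1P[a aE] : gaps w == 1%N by rewrite eqn_leq g.
  by exists a => i ia; move/setP/(_ i): aE; rewrite !inE (negPf ia) => ->.
have step i : i != a -> s (i + 1) = s i + 1 \/ s (i + 1) = s i - 1.
  move=> /ha; case wi : (w i) => [[]|//] _.
    have : arr w i (i + 1) by rewrite arr_succ wi.
    rewrite -arrE /arr => /orP[] /andP[/eqP E _]; [by left|right].
    by rewrite E addrK.
  have : arr w (i + 1) i by rewrite arr_pred wi.
  rewrite -arrE /arr => /orP[] /andP[/eqP E _]; [right|by left].
  by rewrite E addrK.
have na t : (t < n.+2)%N -> a + 1 + t%:R != a.
  move=> tn; rewrite -[a + 1 + _]addrA nat1r -subr_eq0 addrAC subrr add0r residue_eq0 gtnNdvd //; lia.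
have [e [eE he]] : exists e : 'I_n.+3, (e = 1 \/ e = -1) /\ forall t, (t < n.+3)%N ->
    s (a + 1 + t%:R) = s (a + 1) + e * t%:R.
  have [e [eE e1]] : exists e : 'I_n.+3, (e = 1 \/ e = -1) /\ s (a + 1 + 1) = s (a + 1) + e.
    have [] := step (a + 1); first by have := na 0%N isT; rewrite addr0.
    - by exists 1; split; [left|].
    - by exists (-1); split; [right|].
  exists e; split=> //.
  have main t : (t < n.+2)%N -> s (a + 1 + t%:R) = s (a + 1) + e * t%:R /\
      s (a + 1 + t.+1%:R) = s (a + 1) + e * t.+1%:R.
    elim: t => [|t IH] tn; first by rewrite mulr0 !addr0 mulr1.
    have [IH1 IH2] := IH (ltnW tn); split=> //.
    have E : a + 1 + t.+2%:R = a + 1 + t.+1%:R + 1 by rewrite -[t.+2%:R]natr1 addrA.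
    have ne : s (a + 1 + t.+2%:R) != s (a + 1 + t%:R).
      rewrite (inj_eq perm_inj) E -[t.+1%:R]natr1 addrA; exact: addr2_neq.
    have eo : e * t.+2%:R = e * t.+1%:R + e by rewrite -[t.+2%:R]natr1 mulrDr mulr1.
    have eo' : e * t.+1%:R = e * t%:R + e by rewrite -[t.+1%:R]natr1 mulrDr mulr1.
    have := step (a + 1 + t.+1%:R) (na _ tn); rewrite -E.
    have -> : s (a + 1) + e * t.+2%:R = s (a + 1 + t.+1%:R) + e by rewrite eo IH2 addrA.
    case: eE => eE [] h; rewrite h eE //; move: ne; rewrite h IH1 IH2 eo' eE.
      by rewrite addrA addrK eqxx.
    by rewrite addrA subrK eqxx.
  case=> [|t] tn; first by rewrite mulr0 !addr0.
  by have [] := main t tn.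
have sE i : s i = s (a + 1) - e * (a + 1) + e * i.
  have [t tn ->] := residue_shift (a + 1) i; rewrite he //; ring.
have wE i b : (w i == Some b) = (if b then arr w' (s i) (s (i + 1)) else arr w' (s (i + 1)) (s i)).
  by case: b; rewrite arrE ?arr_succ ?arr_pred.
have optE (u v : option bool) : (forall b, (u == Some b) = (v == Some b)) -> u = v.
  by case: u v => [[]|] [[]|] // h; have := h true; have := h false.
set k0 := s (a + 1) - e * (a + 1) in sE; case: eE => eE.
  exists (false, k0); apply/ffunP => i; rewrite ffunE /=; apply: optE => b.
  have s1 j : s j = j + k0 by rewrite sE eE mul1r addrC.
  by rewrite wE !s1 addrAC arr_succ arr_pred; case: b.
(* The reflection with parameter k acts on vertices by k + 1 - i, whence the shift by one. *)
exists (true, k0 - 1); apply/ffunP => i; rewrite ffunE /=; apply: optE => b.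
have s1 : s i = k0 - 1 - i + 1 by rewrite sE eE; ring.
have s2 : s (i + 1) = k0 - 1 - i by rewrite sE eE; ring.
rewrite wE s1 s2 arr_succ arr_pred.
by case: b; case: (w' _) => // -[].
Qed.

End DihedralWords.

(** * Counting words *)

(** These k are the multiples j e with j < d coprime to d. *)
Lemma card_gcdn_eq N d e : (0 < N)%N -> N = (d * e)%N ->
  #|[set k : 'I_N | gcdn k N == e]| = totient d.
Proof.
move=> N0 NE; subst N; move: N0; rewrite muln_gt0 => /andP[d0 e0].
have fP (j : 'I_d) : (j * e < d * e)%N by rewrite ltn_pmul2r.
pose f j := Ordinal (fP j).
have f_inj : injective f.
  by move=> i j [] /eqP; rewrite eqn_pmul2r // => /eqP/ord_inj.
rewrite totient_count_coprime big_mkord.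
have -> : (\sum_(j < d) coprime d j = #|[set j : 'I_d | coprime d j]|)%N.
  by rewrite -sum1dep_card [RHS]big_mkcond; apply: eq_bigr => j _; case: (coprime _ _).
rewrite -(card_imset _ f_inj).
apply: eq_card => k; rewrite inE; apply/eqP/imsetP => [ge|[j]]; last first.
  by rewrite inE => /eqP dj ->; rewrite /= -muln_gcdl gcdnC dj mul1n.
have [j kE] : exists j, (k = j * e :> nat)%N.
  by apply/dvdnP; have := dvdn_gcdl k (d * e); rewrite ge.
have jd : (j < d)%N by rewrite -(ltn_pmul2r e0) -kE.
exists (Ordinal jd); last by apply: ord_inj; rewrite kE.
rewrite inE /coprime gcdnC /= -(eqn_pmul2r e0) muln_gcdl -kE ge mul1n.
by [].
Qed.

Lemma sum_gcdn (F : nat -> nat) (N : nat) : (0 < N)%N ->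
  (\sum_(k < N) F (gcdn k N) = \sum_(d <- divisors N) F (N %/ d) * totient d)%N.
Proof.
move=> N0.
have gN k : (gcdn k N %| N)%N by apply: dvdn_gcdr.
have divK g : (g %| N)%N -> (N %/ (N %/ g) = g)%N.
  by move=> gd; rewrite -[X in (X %/ _)%N](divnK gd) mulKn // divn_gt0 ?(dvdn_gt0 N0) // dvdn_leq.
have divN g : (g %| N)%N -> (N %/ g %| N)%N.
  by move=> gd; rewrite -[X in (_ %| X)%N](divnK gd) dvdn_mulr.
transitivity (\sum_(k < N) \sum_(d <- divisors N | d == (N %/ gcdn k N)%N) F (N %/ d))%N.
  apply: eq_bigr => k _.
  rewrite big_mkcond (bigD1_seq (N %/ gcdn k N)%N) ?divisors_uniq -?dvdn_divisors ?divN //=.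
  by rewrite eqxx divK // big1 ?addn0 // => d /negPf->.
rewrite (exchange_big_dep xpredT) //= !big_seq; apply: eq_bigr => d; rewrite -dvdn_divisors // => dN.
rewrite sum_nat_const mulnC; congr (_ * _)%N.
rewrite -(@card_gcdn_eq N d (N %/ d)) ?[(d * _)%N]mulnC ?divnK //.
apply: eq_card => k; rewrite inE unfold_in /=.
by apply/eqP/eqP => ->; rewrite divK.
Qed.

(** By Bezout, invariance under k amounts to invariance under g = gcd(k, n + 3), so the first g
    letters are free and determine the word. *)
Lemma card_rot_words n (k : 'I_n.+3) :
  #|[set w : word n | (gaps w == 0%N) && (dihedral (false, k) w == w)]|
  = (2 ^ gcdn k n.+3)%N.
Proof.
set g := gcdn k n.+3; have g0 : (0 < g)%N by rewrite gcdn_gt0 orbT.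
have gN : (g %| n.+3)%N by apply: dvdn_gcdr.
have gk : (g %| k)%N by apply: dvdn_gcdl.
pose c (b : {ffun 'I_g -> bool}) : word n :=
  [ffun i : 'I_n.+3 => Some (b (Ordinal (ltn_pmod i g0)))].
have c_inj : injective c.
  move=> b b' /ffunP E; apply/ffunP => r.
  have rN : (r < n.+3)%N by apply: leq_trans (ltn_ord r) (dvdn_leq _ gN).
  have := E (Ordinal rN); rewrite !ffunE => -[].
  suff -> : Ordinal (ltn_pmod (Ordinal rN) g0) = r by [].
  by apply: val_inj; rewrite /= modn_small.
have <- : #|{ffun 'I_g -> bool}| = (2 ^ g)%N by rewrite card_ffun card_bool card_ord.
rewrite -(card_imset _ c_inj).
apply: eq_card => w; rewrite inE; apply/andP/imsetP => [[]|[b _ ->]]; last first.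
  split; first by rewrite cards_eq0; apply/eqP/setP => i; rewrite !inE ffunE.
  apply/eqP/ffunP => i; rewrite !ffunE /=; congr (Some (b _)); apply: val_inj => /=.
  by rewrite modn_dvdm // -modnDmr (eqP gk) addn0.
rewrite cards_eq0 => /eqP/setP w0 /eqP/ffunP wk.
have {wk} wk i : w (i + k) = w i by have := wk i; rewrite ffunE.
have wmk i m : w (i + (m * k)%:R) = w i.
  elim: m i => [|m IH] i; first by rewrite addr0.
  by rewrite mulSn natrD addrA IH residue_val wk.
have wg i : w (i + g%:R) = w i.
  have [a _ da] := @Bezoutl n.+3 k isT; rewrite -(wmk _ a) -addrA -natrD.
  have /eqP -> : ((g + a * k)%:R : 'I_n.+3) == 0 by rewrite residue_eq0 /g gcdnC.
  by rewrite addr0.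
have wmg i m : w (i + (m * g)%:R) = w i.
  by elim: m i => [|m IH] i; [rewrite addr0 | rewrite mulSn natrD addrA IH].
exists [ffun r : 'I_g => w r%:R == Some true] => //.
apply/ffunP => i; rewrite !ffunE /=.
have <- : w i = w (i %% g)%N%:R.
  by rewrite -[RHS](wmg _ (i %/ g)%N) -natrD addnC -divn_eq residue_val.
by have := w0 i; rewrite !inE; case: (w i) => // -[].
Qed.

Lemma card_gap_words n : #|[set w : word n | gaps w == 1%N]| = (n.+3 * 2 ^ n.+2)%N.
Proof.
have E a : #|[set w : word n | [set i | w i == None] == [set a]]| = (2 ^ n.+2)%N.
  have <- : #|pffun_on None (predC1 a) (predC1 (None : option bool))| = (2 ^ n.+2)%N.
    rewrite card_pffun_on; congr (_ ^ _)%N.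
      by rewrite cardC1 card_option card_bool.
    by rewrite cardC1 card_ord.
  apply: eq_card => w; rewrite inE; apply/eqP/pffun_onP => [/setP h|[h1 h2]].
    split; first by apply/subsetP => i; have := h i; rewrite !inE => ->.
    move=> x /imageP[i]; rewrite !inE => ia ->; have := h i.
    by rewrite !inE (negPf ia) => ->.
  apply/setP => i; rewrite !inE; have [->|ia] := eqVneq i a.
    by apply/negPn/negP => wa; have /subsetP/(_ a) := h1; rewrite !inE wa eqxx => /(_ isT).
  by apply/negbTE; apply: (h2 (w i)); apply/imageP; exists i; rewrite // !inE.
rewrite -sum1_card.
(* Sort by the position of the gap; as a gap exists, the default [ord0] is never taken. *)
rewrite (partition_big (fun w : word n => odflt ord0 [pick a | w a == None]) xpredT) //=.
rewrite -[X in (X * _)%N]card_ord -sum_nat_const; apply: eq_bigr => a _.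
rewrite -(E a) sum1dep_card; apply: eq_card => w; rewrite !inE.
have mem (b i : 'I_n.+3) : [set i | w i == None] = [set b] -> (w i == None) = (i == b).
  by move/setP/(_ i); rewrite !inE.
apply/andP/eqP => [[/cards1P[b hb]]|ha].
  case: pickP => [c|/(_ b)]; rewrite (mem b _ hb) ?eqxx //.
  by move/eqP => -> /= /eqP <-.
split; first by rewrite /gaps ha cards1.
by case: pickP => [c|/(_ a)]; rewrite (mem a _ ha) ?eqxx.
Qed.

Section Antisymmetric.
Variables (n : nat) (tau : 'I_n -> 'I_n).
Hypothesis tauK : involutive tau.

Let A : {set 'I_n} := [set i : 'I_n | (i < tau i)%N].
Let Fix : {set 'I_n} := [set i : 'I_n | tau i == i].

Let cardA : n = (#|A| * 2 + #|Fix|)%N.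
Proof.
have tau_inj := inv_inj tauK.
have imA i : (i \in tau @: A) = (tau i < i)%N.
  by rewrite -{1}[i]tauK mem_imset // inE tauK.
rewrite -[LHS]card_ord -cardsT -(cardsID Fix setT) setTI addnC; congr (_ + _)%N.
have -> : setT :\: Fix = A :|: tau @: A.
  by apply/setP => i; rewrite in_setU imA !inE andbT -val_eqE neq_ltn orbC.
rewrite cardsU disjoint_setI0 ?cards0 ?subn0 ?card_imset //; first by rewrite muln2 addnn.
by apply/pred0P => i; rewrite /= imA inE; case: ltngtP.
Qed.

(** One letter is free in each two-element orbit of [tau]; the set [A] contains the smaller member
    of each. *)
Lemma card_antisymmetric_words :
  #|[set w : {ffun 'I_n -> option bool} | [forall i, (w i == None) == (tau i == i)]
      && [forall i, w (tau i) == omap negb (w i)]]| = (2 ^ ((n - #|Fix|) %/ 2))%N.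
Proof.
have -> : ((n - #|Fix|) %/ 2 = #|A|)%N by rewrite {1}cardA addnK mulnK.
pose f (C : {set 'I_n}) : {ffun 'I_n -> option bool} := [ffun i =>
  if tau i == i then None else Some (if (i < tau i)%N then i \in C else tau i \notin C)].
have f_inj : {in powerset A &, injective f}.
  move=> C C'; rewrite !inE => CA CA' /ffunP E; apply/setP => i.
  case: (boolP (i \in A)) => iA; last first.
    have nA (D : {set 'I_n}) : D \subset A -> (i \in D) = false.
      by move/subsetP => DA; apply: contraNF iA; apply: DA.
    by rewrite !nA.
  move: iA (E i); rewrite inE !ffunE => it.
  have ni : (tau i == i) = false by rewrite -val_eqE gtn_eqF.
  by rewrite ni it => -[].
rewrite -card_powerset -(card_in_imset f_inj); apply: eq_card => w.
rewrite inE; apply/andP/imsetP => [[/forallP h1 /forallP h2]|[C _ ->]].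
  exists [set i in A | w i == Some true]; first by rewrite inE; apply/subsetP => i /setIdP[].
  apply/ffunP => i; rewrite ffunE !inE -(eqP (h1 i)) tauK.
  have := h1 i; have := h2 i; case: ltngtP => [it|it|/ord_inj it].
  - by case: (w i) => // -[].
  - by move=> /eqP ->; case: (w i) => // -[].
  - by rewrite -{2}it eqxx => _ /eqP; case: eqP.
split; apply/forallP => i; rewrite !ffunE; first by case: ifP.
rewrite tauK [i == _]eq_sym; case: ifP => //= /negbT; rewrite -val_eqE.
by case: ltngtP => //= _ _; rewrite ?negbK.
Qed.

End Antisymmetric.

(** * Orbits *)

Section Burnside.
Variable n : nat.
Local Notation N := n.+3.
Implicit Types (w : word n) (x : bool * 'I_N).

Definition dihedral_perm x : {perm word n} := perm (@dihedral_inj n x).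
Definition dihedral_set : {set {perm word n}} := [set dihedral_perm x | x : bool * 'I_N].

(** A constant word tells rotations from reflections, and a word with one distinguished letter
    determines the parameter. *)
Lemma dihedral_perm_inj : injective dihedral_perm.
Proof.
move=> [e k] [e' k'] /permP E.
have ee' : e = e'.
  have /ffunP/(_ 0) := E [ffun=> Some true]; rewrite !permE /dihedral.
  by case: e e' {E} => -[]; rewrite /= !ffunE.
rewrite -ee' in E *; congr (_, _).
have /ffunP := E [ffun i => Some (i == 0)]; rewrite !permE /dihedral.
case: e {E ee'} => /= E.
  have := E k; rewrite !ffunE subrr eqxx /= => -[].
  by move/esym/negbFE; rewrite subr_eq0 => /eqP.
have := E (- k); rewrite !ffunE addNr eqxx => -[].
by move/esym; rewrite addrC subr_eq0 => /eqP.
Qed.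

Lemma dihedral_group_set : group_set dihedral_set.
Proof.
apply/group_setP; split.
  apply/imsetP; exists (false, 0) => //; apply/permP => w.
  by rewrite perm1 permE dihedral1.
move=> _ _ /imsetP[x _ ->] /imsetP[y _ ->].
have [z hz] := dihedral_comp x y.
by apply/imsetP; exists z => //; apply/permP => w; rewrite permM !permE hz.
Qed.
Canonical dihedral_group := Group dihedral_group_set.

Lemma card_dihedral_group : #|dihedral_set| = (2 * N)%N.
Proof.
by rewrite card_imset; [rewrite card_prod card_bool card_ord | apply: dihedral_perm_inj].
Qed.

Lemma mem_dihedral_orbit w w' :
  reflect (exists x, w = dihedral x w') (w \in orbit 'P dihedral_set w').
Proof.
apply: (iffP orbitP) => [[_ /imsetP[x _ ->]] <-|[x ->]].
  by exists x; rewrite /= apermE permE.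
by exists (dihedral_perm x); rewrite ?imset_f //= apermE permE.
Qed.

Lemma dihedral_acts (S : {set word n}) :
  (forall x w, (dihedral x w \in S) = (w \in S)) -> [acts dihedral_set, on S | 'P].
Proof.
move=> hS; apply/actsP => _ /imsetP[x _ ->] w.
by rewrite /= apermE permE hS.
Qed.

Let A := [set w : word n | (gaps w <= 1)%N].
Let U := [set w : word n | unimodal w].
Let S := [set w : word n | good_word w].

(** A nontrivial rotation moves a single gap, so words with one gap are fixed by the identity
    only. *)
Lemma card_fixed_rotation (k : 'I_N) :
  #|[set w in A | dihedral (false, k) w == w]|
  = (2 ^ gcdn k N + (k == 0%R) * (N * 2 ^ n.+2))%N.
Proof.
rewrite -card_rot_words -card_gap_words.
rewrite -(cardsID [set w : word n | gaps w == 0%N]); congr (_ + _)%N.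
  apply: eq_card => w; rewrite !inE andbC; case: eqP => //= ->.
  by rewrite andTb.
have [->|k0] := eqVneq k 0.
  rewrite mul1n; apply: eq_card => w; rewrite !inE dihedral1 eqxx andbT.
  by case: (gaps w) => [|[]].
apply/eqP; rewrite mul0n cards_eq0; apply/eqP/setP => w; rewrite !inE.
apply/and3P => -[g0 g1 /eqP/ffunP wk].
have /cards1P[a aE] : gaps w == 1%N by move: g0 g1; case: (gaps w) => [|[]].
have wa i : (w i == None) = (i == a) by move/setP/(_ i): aE; rewrite !inE.
have := wa (a + k); have := wk a; rewrite ffunE /= => ->.
by rewrite wa eqxx -subr_eq0 addrAC subrr add0r (negPf k0).
Qed.

(** A letter at a fixed position would equal its own negation, so fixed positions are gaps.
    Conversely the mirror image of the only gap is a gap, hence the gap itself. *)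
Lemma card_fixed_reflection (k : 'I_N) (f := #|[set i | k - i == i]|) :
  #|[set w in A | dihedral (true, k) w == w]|
  = (if (f <= 1)%N then 2 ^ ((N - f) %/ 2) else 0)%N.
Proof.
have tauK : involutive (fun i => k - i) by move=> i; rewrite subKr.
have fixE w : dihedral (true, k) w == w -> (gaps w <= 1)%N ->
    forall i, (w i == None) = (k - i == i).
  move=> /eqP/ffunP wk g i.
  have {}wk j : omap negb (w (k - j)) = w j by have := wk j; rewrite ffunE.
  apply/eqP/eqP => [wi|ki].
    have wki : w (k - i) = None by have := wk i; rewrite wi; case: (w _).
    by move/card_le1_eqP: g; apply; rewrite inE ?wi ?wki.
  by have := wk i; rewrite ki; case: (w i) => // -[].
have gapsE w : (forall i, (w i == None) = (k - i == i)) -> gaps w = f.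
  by move=> h; apply: eq_card => i; rewrite !inE h.
case: ifP => f1.
  rewrite -(card_antisymmetric_words tauK) -/f; apply: eq_card => w; rewrite !inE.
  apply/andP/andP => [[g wk]|[/forallP h1 /forallP h2]].
    split; first by apply/forallP => i; rewrite (fixE w).
    by apply/forallP => i; rewrite -{1}(eqP wk) ffunE /= subKr.
  split; first by rewrite (gapsE w (fun i => eqP (h1 i))).
  by apply/eqP/ffunP => i; rewrite ffunE /= -(eqP (h2 _)) subKr.
apply/eqP; rewrite cards_eq0; apply/eqP/setP => w; rewrite !inE.
by apply/andP => -[g wk]; rewrite -(gapsE _ (fixE _ wk g)) g in f1.
Qed.

(** Solve 2i = k modulo N: doubling is bijective for odd N; for even N and k both k/2 and k/2 + N/2
    are solutions. *)
Lemma card_reflection_fixpoints (k : 'I_N) (f := #|[set i | k - i == i]|) :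
  if odd N then f = 1%N else if odd k then f = 0%N else (1 < f)%N.
Proof.
have fE i : (k - i == i) = (k == i + i) by rewrite subr_eq.
have modE (i : 'I_N) : nat_of_ord (i + i) = (i.*2 %% N)%N by rewrite -addnn.
case: ifP => oN.
  pose g (i : 'I_N) := i + i.
  have g_inj : injective g.
    move=> i j; rewrite /g => /eqP; rewrite -subr_eq0.
    have -> : i + i - (j + j) = (2 * nat_of_ord (i - j)%R)%N%:R.
      by rewrite natrM residue_val; ring.
    rewrite residue_eq0 Gauss_dvdr; last by rewrite coprimen2.
    by rewrite -residue_eq0 residue_val subr_eq0 => /eqP.
  apply/eqP/cards1P; exists (invF g_inj k); apply/setP => i; rewrite !inE fE.
  by rewrite -(can2_eq (f_invF g_inj) (invF_f g_inj)) eq_sym.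
case: ifP => ok.
  apply/eqP; rewrite cards_eq0; apply/eqP/setP => i; rewrite !inE fE.
  apply/eqP => kE; move: ok; rewrite kE modE odd_mod ?odd_double //.
have kk : (k./2%:R + k./2%:R : 'I_N) = k.
  by rewrite -natrD addnn even_halfK ?ok // residue_val.
have NN : ((N./2)%:R + (N./2)%:R : 'I_N) = 0.
  by rewrite -natrD addnn even_halfK ?oN // residue_full.
apply/card_gt1P; exists (k./2%:R), (k./2%:R + (N./2)%:R); rewrite !inE !fE.
split; first by rewrite kk.
  by rewrite addrACA kk NN addr0.
rewrite -subr_eq0 opprD addrA subrr add0r oppr_eq0 residue_eq0 gtnNdvd //.
by rewrite ltn_half_double -addnn -addn1 leq_add2l.
Qed.

Lemma sum_fixed_reflections :
  (\sum_(k < N) #|[set w in A | dihedral (true, k) w == w]| =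
   if odd N then N * 2 ^ (N.-1 %/ 2) else N %/ 2 * 2 ^ (N %/ 2))%N.
Proof.
have odds m : (\sum_(k < m) odd k = m %/ 2)%N.
  by elim: m => [|m IH]; rewrite ?big_ord0 // big_ord_recr /= IH; lia.
under eq_bigr do rewrite card_fixed_reflection.
case: ifP => oN.
  rewrite -[X in (X * _)%N]card_ord -sum_nat_const; apply: eq_bigr => k _.
  by have := card_reflection_fixpoints k; rewrite oN => ->; rewrite subn1.
rewrite -{1}(odds N) big_distrl /=; apply: eq_bigr => k _.
have := card_reflection_fixpoints k; rewrite oN; case: (odd k) => [->|].
  by rewrite subn0 /= mul1n.
by rewrite /= ltnNge => /negPf ->; rewrite mul0n.
Qed.

Lemma card_dihedral_orbits :
  (#|orbit 'P dihedral_set @: A| * (2 * N) =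
   N * 2 ^ n.+2 + \sum_(d <- divisors N) 2 ^ (N %/ d) * totient d +
   if odd N then N * 2 ^ (N.-1 %/ 2) else N %/ 2 * 2 ^ (N %/ 2))%N.
Proof.
have acts : [acts dihedral_set, on A | 'P].
  by apply: dihedral_acts => x w; rewrite !inE gaps_dihedral.
rewrite -card_dihedral_group -(Frobenius_Cauchy acts) /=.
rewrite big_imset /=; last by move=> x y _ _; apply: dihedral_perm_inj.
have fixE x : #|('Fix_(A | 'P)[dihedral_perm x])%g| = #|[set w in A | dihedral x w == w]|.
  by apply: eq_card => w; rewrite !inE sub1set !inE /= apermE permE.
under eq_bigr do rewrite fixE.
rewrite -(pair_bigA _ (fun e k => #|[set w in A | dihedral (e, k) w == w]|)) /=.
rewrite big_bool /= sum_fixed_reflections addnC; congr (_ + _)%N.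
under eq_bigr do rewrite card_fixed_rotation.
rewrite big_split /= (@sum_gcdn (fun g => 2 ^ g)%N) // addnC; congr (_ + _)%N.
by rewrite (bigD1 ord0) //= big1 ?addn0 ?mul1n // => k /negPf ->.
Qed.

Definition block (l : nat) : word n := [ffun i : 'I_N => Some (i < l)%N].

Lemma unimodal_blockP w : reflect
  (exists l x, (l <= N %/ 2)%N /\ w = dihedral x (block l)) (unimodal w).
Proof.
(* Reading backwards with negated letters exchanges the lengths l and N - l, so blocks up to half
   the length suffice. *)
have blockN l : (l <= N)%N -> dihedral (true, n.+2%:R) (block l) = block (N - l).
  move=> ln; apply/ffunP => i; rewrite !ffunE.
  have -> : (true, n.+2%:R).2 - i = (n.+2 - i)%N%:R.
    by rewrite natrB ?residue_val // -ltnS.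
  rewrite val_residue modn_small; last by rewrite ltnS leq_subr.
  by congr Some; have := ltn_ord i; lia.
have block_uni l : (l <= N)%N -> unimodal (block l).
  move=> ln; apply/unimodalP; exists 0, l; split=> // t tn.
  by rewrite ffunE add0r val_residue modn_small.
apply: (iffP idP) => [/unimodalP[i [l [ln h]]]|[l [x [ln ->]]]]; last first.
  by rewrite unimodal_dihedral block_uni // (leq_trans ln) ?leq_div.
have wE : w = dihedral (false, - i) (block l).
  apply/ffunP => j; rewrite !ffunE -[_ + _.2]/(j - i) -h; last exact: ltn_ord.
  by congr (w _); rewrite residue_val addrC subrK.
have [l2|l2] := leqP l (N %/ 2); first by exists l, (false, - i).
have [z hz] := @dihedral_comp n (true, n.+2%:R) (false, - i).
exists (N - l)%N, z; split; first by lia.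
by rewrite -hz blockN ?leq_subr // subKn.
Qed.

(** Rotations preserve the number of forward letters and reflections of gapless words replace it by
    its complement to N, so distinct blocks of length at most N/2 lie in distinct orbits. *)
Lemma card_unimodal_orbits : #|orbit 'P dihedral_set @: U| = (N %/ 2).+1.
Proof.
pose f (l : 'I_(N %/ 2).+1) := orbit 'P dihedral_set (block l).
have -> : orbit 'P dihedral_set @: U = f @: setT.
  apply/setP => O; apply/imsetP/imsetP => [[w]|[l _ ->]].
    rewrite inE => /unimodal_blockP[l [x [l2 wE]]] ->.
    exists (Ordinal (l2 : l < (N %/ 2).+1)%N) => //; apply/orbit_eqP/mem_dihedral_orbit.
    by exists x.
  exists (block l) => //; rewrite inE; apply/unimodal_blockP; exists l, (false, 0).
  by rewrite dihedral1; split=> //; rewrite -ltnS.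
rewrite card_imset ?cardsT ?card_ord // => l l' /orbit_eqP/mem_dihedral_orbit[[e k] E].
pose weight w := #|[set i | w i == Some true]|.
have block_weight (u : 'I_(N %/ 2).+1) : weight (block u) = u.
  have uN : (u <= N)%N by apply: leq_trans (leq_div _ _); rewrite -ltnS.
  rewrite /weight -sum1dep_card.
  transitivity (\sum_(i < N | (i < u)%N) 1)%N.
    by apply: eq_bigl => i; rewrite ffunE; case: (i < u)%N.
  by rewrite (big_ord_narrow uN) sum1_card card_ord.
have rot_weight w : weight (dihedral (false, k) w) = weight w.
  pose v (i : 'I_N) := i + k; have v_inj : injective v by move=> i j /addIr.
  rewrite /weight -(card_imset _ v_inj); apply: eq_card => i.
  by rewrite -[i](subrK k) -/(v (i - k)) mem_imset // !inE ffunE.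
have refl_weight w : gaps w = 0%N -> (weight (dihedral (true, k) w) + weight w = N)%N.
  move/eqP; rewrite cards_eq0 => /eqP/setP g0.
  pose v (i : 'I_N) := k - i; have v_inj : injective v by move=> i j /addrI/oppr_inj.
  rewrite addnC /weight -[RHS]card_ord -(cardsC [set i | w i == Some true]); congr (_ + _)%N.
  rewrite -(card_imset _ v_inj); apply: eq_card => i.
  rewrite -[i](subKr k) -/(v (k - i)) mem_imset // !inE ffunE /v subKr.
  by have := g0 i; rewrite !inE; case: (w _) => // -[].
apply: ord_inj; rewrite -(block_weight l) E; case: e E => E; last first.
  by rewrite rot_weight block_weight.
have gl : gaps (block l') = 0%N.
  by apply/eqP; rewrite cards_eq0; apply/eqP/setP => i; rewrite !inE ffunE.
have := refl_weight _ gl; rewrite -E !block_weight.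
by have := ltn_ord l; have := ltn_ord l'; lia.
Qed.

Lemma card_good_orbits :
  (#|orbit 'P dihedral_set @: S| + (N %/ 2).+1 = #|orbit 'P dihedral_set @: A|)%N.
Proof.
rewrite -card_unimodal_orbits.
have -> : A = S :|: U.
  apply/setP => w; rewrite !inE /good_word; case: (boolP (unimodal w)) => [/unimodalP[i [l [ln h]]]|_].
    rewrite orbT; apply/card_le1_eqP => j; rewrite inE.
    by have [t tn ->] := residue_shift i j; rewrite h.
  by rewrite andbT orbF.
rewrite imsetU cardsU disjoint_setI0 ?cards0 ?subn0 //.
apply/pred0P => O; apply/andP => -[/imsetP[w + ->] /imsetP[w' + /orbit_eqP/mem_dihedral_orbit[x E]]].
by rewrite !inE /good_word E unimodal_dihedral => /andP[_ /negPf ->].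
Qed.

End Burnside.

(** * Isomorphism classes and the closed formula *)

Lemma num_iso_classes_words n :
  num_iso_classes (@nnegA n.+3)
    #|orbit 'P (dihedral_set n) @: [set w : word n | good_word w]|.
Proof.
set Os := _ @: _.
have /fin_all_exists[rep repP] (a : 'I_#|Os|) : exists w : word n,
    good_word w /\ enum_val a = orbit 'P (dihedral_set n) w.
  by have /imsetP[w] := enum_valP a; rewrite inE => gw E; exists w.
exists (fun a => word_rel (rep a)); split; first by move=> a; apply: good_word_nnegA; case: (repP a).
split=> [a b|P /nnegA_word[w [gw Pw]]].
  have [ga Ea] := repP a; have [gb Eb] := repP b.
  move=> /(word_rel_iso ga gb) h; apply: enum_val_inj; rewrite Ea Eb.
  exact/orbit_eqP/mem_dihedral_orbit.
have wO : orbit 'P (dihedral_set n) w \in Os by apply: imset_f; rewrite inE.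
have [a aE] : exists a : 'I_#|Os|, enum_val a = orbit 'P (dihedral_set n) w.
  by exists (enum_rank_in wO (orbit 'P (dihedral_set n) w)); apply: enum_rankK_in.
exists a; apply: (poset_iso_trans Pw); have [_] := repP a.
rewrite aE => /orbit_eqP/mem_dihedral_orbit[x ->].
exact: dihedral_word_rel.
Qed.

Lemma num_iso_classes_small n : (n < 2)%N -> num_iso_classes (@nnegA n.+1) 1.
Proof.
move=> n2; exists (fun=> fun i j : 'I_n.+1 => (i <= j)%N); split.
  by move=> _; apply: chain_nnegA.
split; first by move=> a b _; rewrite !ord1.
move=> P [[Prefl [Panti _]] Pconn _ _]; exists ord0.
case: n n2 P Prefl Panti Pconn => [|[|//]] _ P Prefl Panti Pconn.
  by exists 1%g => i j; rewrite !ord1 Prefl.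
have I2 (i : 'I_2) : i = 0 \/ i = 1.
  by case: i => -[|[|//]] il; [left|right]; apply: val_inj.
have : P 0 1 || P 1 0.
  have /connectP[[|z p] //] := Pconn 0 1.
  case/andP => + _ _; rewrite /hasse_und /hasse; have [->|->] := I2 z; rewrite ?eqxx //.
  by case/orP => /and3P[_ -> _]; rewrite ?orbT.
case/orP => [P01|P10].
  have P10 : P 1 0 = false by apply/negP => /(Panti _ _ P01).
  by exists 1%g => i j; rewrite !perm1; have [->|->] := I2 i; have [->|->] := I2 j; rewrite ?Prefl ?P01 ?P10.
have P01 : P 0 1 = false by apply/negP => /(Panti _ _ P10).
exists (tperm 0 1) => i j; have [->|->] := I2 i; have [->|->] := I2 j;
  by rewrite ?tpermL ?tpermR ?Prefl ?P01 ?P10.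
Qed.

Theorem theorem5p7 (n : nat) : (0 < n)%N ->
  exists N : nat, num_iso_classes (@nnegA n) N /\ (N%:R : rat) = Nneg_formula n.
Proof.
case: n => // n _; case: (ltnP n 2) => [n2|].
  by exists 1%N; split; [apply: num_iso_classes_small | rewrite /Nneg_formula n2].
case: n => [|[|n]] // _; eexists; split; first exact: num_iso_classes_words.
have := card_good_orbits n; have := card_dihedral_orbits n.
set b := #|_|; set a := #|_|; set N := n.+3 => hb.
have N0 : (2 * N)%:R != 0 :> rat by rewrite pnatr_eq0.
pose Z := (if odd N then 2 ^ ((N - 3) %/ 2) else 2 ^ (N %/ 2 - 2))%N.
(* Rewrite the Burnside sum so that 2N can be divided out of the gap term and of the reflection
   term. *)
have {}hb : (b * (2 * N) = 2 * N * 2 ^ (N - 2) +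
    \sum_(d <- divisors N) 2 ^ (N %/ d) * totient d + 2 * N * Z)%N.
  rewrite hb; congr (_ + _ + _)%N; first by rewrite /N subn2 /= expnS; ring.
  rewrite /Z; case: ifP => oN.
    have -> : (N.-1 %/ 2 = ((N - 3) %/ 2).+1)%N by rewrite /N; lia.
    by rewrite expnS; ring.
  have N4 : (4 <= N)%N by move: oN; rewrite /N; case: (n).
  have hN : (N = 2 * (N %/ 2))%N by move: oN; lia.
  have -> : (2 ^ (N %/ 2) = 4 * 2 ^ (N %/ 2 - 2))%N by rewrite -(expnD 2 2) subnKC //; lia.
  by rewrite {3}hN; ring.
move=> ab; have -> : a%:R = b%:R - (N %/ 2).+1%:R :> rat by rewrite -ab natrD addrK.
have -> : Nneg_formula N = (2 ^ (N - 2))%:R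
  + (\sum_(d <- divisors N) 2 ^ (N %/ d) * totient d)%:R / (2 * N)%:R + Z%:R - (N %/ 2).+1%:R.
  (* The number floor(N/2) + 1 of excluded orbits is the ceiling of (N + 1)/2. *)
  by rewrite /Nneg_formula /Z (fun_if (fun k : nat => k%:R : rat)) [in RHS](_ : (N %/ 2).+1 = uphalf N.+1) // divn2.
congr (_ - _); apply: (mulIf N0).
rewrite !mulrDl divfK // -!natrM -!natrD hb; congr (_%:R).
by rewrite [(2 ^ _ * _)%N]mulnC [(Z * _)%N]mulnC.
Qed.
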